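(* Suppose that at least one of the following holds: (i) $\beta_2=\beta_3=0$ and $y$ has mean zero and variance one with $\mathbb{E}|y|^3<\infty$; (ii) the first four moments of $y$ match the first four moments of a standard Gaussian random variable. If ultrametricity holds in the mixed $p$-spin model with Gaussian disorder, that is, if $$\lim_{N\to\infty}\mathbb{E}\big\langle I\big(R_{2,3}+\varepsilon\le\min(R_{1,2},R_{1,3})\big)\big\rangle_g=0\qquad\forall\,\varepsilon>0,$$ then it also holds for the disorder $y$, that is, $$\lim_{N\to\infty}\mathbb{E}\big\langle I\big(R_{2,3}+\varepsilon\le\min(R_{1,2},R_{1,3})\big)\big\rangle_y=0\qquad\forall\,\varepsilon>0.$$
   Context: Mixed $p$-spin model: let $\Sigma_N=\{-1,1\}^N$, let $(\beta_p)_{p\ge2}$ be nonnegative numbers with $\sum_{p\ge2}2^p\beta_p^2<\infty$, and let $h\in\mathbb{R}$ (these and the law of $y$ do not depend on $N$). For independent, identically distributed random variables $y_{i_1,\ldots,i_p}$ ($p\ge2$, $1\le i_1,\ldots,i_p\le N$) with common law that of a random variable $y$ with mean zero and variance one, the Hamiltonian is $$X(\sigma)=\sum_{p\ge2}\frac{\beta_p}{N^{(p-1)/2}}\sum_{1\le i_1,\ldots,i_p\le N}y_{i_1,\ldots,i_p}\sigma_{i_1}\cdots\sigma_{i_p}+h\sum_{i=1}^N\sigma_i,\qquad \sigma\in\Sigma_N,$$ with Gibbs measure $G(\sigma)=\exp(X(\sigma))/\sum_{\sigma'\in\Sigma_N}\exp(X(\sigma'))$. $\langle\cdot\rangle_y$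 denotes the expectation over i.i.d. samples (replicas) $\sigma^1,\sigma^2,\ldots$ from this Gibbs measure, conditionally on the disorder; $\langle\cdot\rangle_g$ denotes the same object when the disorder variables are i.i.d. standard Gaussian. $\mathbb{E}$ is the expectation over the disorder, $I(\cdot)$ is the indicator function, and $R_{\ell,\ell'}:=\frac1N\sum_{i=1}^N\sigma_i^\ell\sigma_i^{\ell'}$ is the overlap between $\sigma^\ell$ and $\sigma^{\ell'}$. *)

(* Defs.v *)
From HB Require Import structures.
From mathcomp Require Import all_boot all_order all_algebra.
From mathcomp Require Import all_classical all_reals all_analysis.

Set Implicit Arguments.
Unset Strict Implicit.
Unset Printing Implicit Defensive.

Import Order.TTheory GRing.Theory Num.Theory.
Import numFieldNormedType.Exports.

Local Open Scope classical_set_scope.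
Local Open Scope ring_scope.

(* Sigma_N = {-1, 1}^N, with the spin -1 encoded by [true] and +1 by [false]. *)
Definition config (N : nat) := {ffun 'I_N -> bool}.

Definition spin (R : realType) (N : nat) (s : config N) (i : 'I_N) : R :=
  (-1) ^+ s i.

(* The index (p, (i_1, ..., i_p)).  The model only involves indices with
   [2 <= p]; nothing is assumed about the variables with [p < 2]. *)
Definition disorder_index (N : nat) := {p : nat & {ffun 'I_p -> 'I_N}}.

Definition model_index (N : nat) : set (disorder_index N) :=
  [set k | (2 <= tag k)%N].

(* For a fixed realisation [x] of the disorder.  The sum over p is the limit of
   its partial sums, an arbitrary real if they diverge; they converge almost
   surely when \sum_p 2 ^ p * beta_p ^ 2 < +oo. *)
Definition hamiltonian (R : realType) (beta : nat -> R) (h : R) (N : nat)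
    (x : disorder_index N -> R) (s : config N) : R :=
  limn (fun n : nat => \sum_(2 <= p < n)
    beta p / N%:R `^ ((p%:R - 1) / 2) *
    \sum_(i : {ffun 'I_p -> 'I_N})
      x (Tagged (fun p => {ffun 'I_p -> 'I_N}) i) *
      \prod_(k < p) spin R s (i k))
  + h * \sum_(i < N) spin R s i.

Definition gibbs (R : realType) (N : nat) (X : config N -> R) (s : config N) : R :=
  expR (X s) / \sum_(s' : config N) expR (X s').

(* <f(sigma^1, sigma^2, sigma^3)>, for three replicas. *)
Definition gibbs_avg3 (R : realType) (N : nat) (X : config N -> R)
    (f : config N -> config N -> config N -> R) : R :=
  \sum_(s1 : config N) \sum_(s2 : config N) \sum_(s3 : config N)
    gibbs X s1 * gibbs X s2 * gibbs X s3 * f s1 s2 s3.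

Definition overlap (R : realType) (N : nat) (s s' : config N) : R :=
  N%:R^-1 * \sum_(i < N) spin R s i * spin R s' i.

Definition nonultrametric (R : realType) (N : nat) (eps : R)
    (s1 s2 s3 : config N) : bool :=
  overlap R s2 s3 + eps <= Num.min (overlap R s1 s2) (overlap R s1 s3).

Definition independent_on (d : measure_display) (T : measurableType d)
    (R : realType) (P : probability T R) (I : eqType) (D : set I)
    (X : I -> {RV P >-> R}) : Prop :=
  forall J : seq I, uniq J -> [set` J] `<=` D ->
  forall A : I -> set R, (forall i, measurable (A i)) ->
    P (\bigcap_(i in [set` J]) (X i @^-1` A i)) =
    (\prod_(i <- J) P (X i @^-1` A i))%E.

Definition iid_on (d : measure_display) (T : measurableType d)
    (R : realType) (P : probability T R) (I : eqType) (D : set I)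
    (X : I -> {RV P >-> R}) (law : set R -> \bar R) : Prop :=
  independent_on D X /\
  forall i, D i -> forall A : set R, measurable A ->
    distribution P (X i) A = law A.

(* The disorder of the system of size N may live on a probability space
   depending on N. *)
Definition ultrametricity (R : realType) (beta : nat -> R) (h : R)
    (d : nat -> measure_display) (T : forall N, measurableType (d N))
    (P : forall N, probability (T N) R)
    (y : forall N, disorder_index N -> {RV (P N) >-> R}) : Prop :=
  forall eps : R, 0 < eps ->
    (fun N : nat => ('E_(P N)[fun w =>
       gibbs_avg3 (hamiltonian beta h (fun k => y N k w))
         (fun s1 s2 s3 => (nonultrametric eps s1 s2 s3)%:R)])%E)
    @ \oo --> 0%E.

(* Main.v *)
Require Import Defs.
From HB Require Import structures.
From mathcomp Require Import all_boot all_order all_algebra.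
From mathcomp Require Import all_classical all_reals all_analysis.
From mathcomp Require Import measurable_realfun ring lra.

Set Implicit Arguments.
Unset Strict Implicit.
Unset Printing Implicit Defensive.

Import Order.TTheory GRing.Theory Num.Theory.
Import numFieldNormedType.Exports.

Local Open Scope classical_set_scope.
Local Open Scope ring_scope.

(** The proof is a Lindeberg replacement argument.  For fixed [N], let [Phi] be
    the three-replica Gibbs average of the indicator of non-ultrametricity, seen
    as a function of the vector of energies.  One disorder variable
    [y_(i_1, ..., i_p)] moves the energies along a direction with entries
    [+-a_p], where [a_p = beta_p N^(-(p-1)/2)].  Along such a line [Phi] is a
    ratio of sums of exponentials, all of whose derivatives are bounded by
    constants independent of [N], of the other variables and of the direction
    ([unif_smooth_gibbs]): the derivative of an average [<f>] is
    [<f S> - <f><S>] with [|S| <= 3].  Taylor's formula ([unif_taylor_min]) then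
    shows that exchanging one variable for a Gaussian one with the same moments
    up to order [m] changes the mean of [Phi] by at most a constant times
    [a_p^m w_m(a_p)], with [w_m(a) = E(|y|^m min(1, a|y|))] summed over the two
    laws ([gibbs_swap]).

    The exchanges are carried out by integrating out one variable at a time
    ([lindeberg_replacement]).  The Taylor coefficients are only used at frozen
    values of the remaining variables, so that they never have to be integrated;
    the independence needed is that of one variable from the sigma-algebra of
    the following ones, for which a pi-lambda argument suffices
    ([ge0_integral_independent_cons]).

    There are [N^p] variables of order [p] and [N^p a_p^2 = beta_p^2 N].
    Under the first condition [m = 2], and [w_2(a) <= a E|y|^3]; for [p >= 4] the
    level contributes at most a constant times [beta_p^2 N^(-1/2)]
    ([level_le_third_moment]).  Under the second one [m = 4], and the level
    contributes at most a constant times [beta_p^2 w_4(B N^(-1/2))], where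
    [w_4(a)] tends to [0] with [a] ([level_le_fourth_moment],
    [capped_moment_cvg0]); a bound by the fifth moment would require one, and
    the bound [a_p^4] alone would not vanish for [p = 2].  In both cases the sum
    over [p] tends to [0] with [N], uniformly in the truncation of the
    Hamiltonian, and [ultrametricity_transfer] concludes.

    The truncation is removed for fixed [N]: the level-[p] energy has second
    moment [beta_p^2 N], and [|Y| <= 2^-p + 2^p Y^2] turns the summability of
    [2^p beta_p^2] into almost sure absolute convergence of the Hamiltonian
    ([ae_cvg_hamiltonian]).  The moments of the Gaussian come from the
    fundamental theorem of calculus applied to its density and to [x] times its
    density. *)

(** * Taylor expansion, uniformly over a family of functions *)

Lemma is_derive_monomial (R : realType) (c x : R) n :
  is_derive x 1 (fun y : R => c * y ^+ n.+1) (c * n.+1%:R * x ^+ n).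
Proof.
have -> : (fun y : R => c * y ^+ n.+1) = c \*: ((@id R) ^+ n.+1 : R -> R).
  by apply/funext => y; rewrite exprfctE.
apply: is_derive_eq.
by rewrite /GRing.scale/= mulr1 mulrA.
Qed.

Lemma is_derive_expR_affine (R : realType) (w s x : R) :
  is_derive x 1 (fun t : R => expR (w + t * s)) (s * expR (w + x * s)).
Proof.
have h : is_derive x 1 (fun t : R => w + t * s) s.
  have -> : (fun t : R => w + t * s) = cst w + s \*: (@id R).
    by apply/funext => y /=; rewrite mulrC.
  have := is_deriveD (is_derive_cst w x 1) (is_deriveZ s (is_derive_id x 1)).
  by rewrite add0r /GRing.scale/= mulr1.
rewrite [X in is_derive _ _ _ X]mulrC.
exact: (@is_derive1_comp _ _ (fun t => w + t * s) _ _ _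
          (is_derive_expR (w + x * s)) h).
Qed.

Lemma is_derive_big_sum (R : realType) (I : Type) (r : seq I)
    (f : I -> R -> R) (df : I -> R) (x : R) :
  (forall i, is_derive x 1 (f i) (df i)) ->
  is_derive x 1 (fun t => \sum_(i <- r) f i t) (\sum_(i <- r) df i).
Proof.
move=> dff; elim: r => [|i r IH].
  under eq_fun do rewrite big_nil.
  by rewrite big_nil; exact: is_derive_cst.
under eq_fun do rewrite big_cons.
by rewrite big_cons; exact: is_deriveD.
Qed.

Section uniformly_smooth.
Variables (R : realType) (I : Type).
Implicit Types F : I -> R -> R.

(** The bounds do not depend on the index: this is how estimates independent of
    the system size, of the other disorder variables and of the direction are
    expressed without computing derivatives. *)
Fixpoint unif_smooth (n : nat) (F : I -> R -> R) : Prop :=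
  (exists M : R, forall i t, `|F i t| <= M) /\
  if n is m.+1 then
    exists F' : I -> R -> R,
      (forall i (t : R), is_derive t 1 (F i) (F' i t)) /\ unif_smooth m F'
  else True.

Lemma unif_smooth_bounded n F : unif_smooth n F ->
  exists M : R, forall i t, `|F i t| <= M.
Proof. by case: n => [|n] []. Qed.

Lemma unif_smoothW n F : unif_smooth n.+1 F -> unif_smooth n F.
Proof.
elim: n F => [|n IH] F [bF [F' [dF sF']]]; split => //.
by exists F'; split => //; exact: IH.
Qed.

Lemma unif_smoothB n F G : unif_smooth n F -> unif_smooth n G ->
  unif_smooth n (fun i t => F i t - G i t).
Proof.
have bnd F1 G1 : (exists M : R, forall i t, `|F1 i t| <= M) ->
    (exists M : R, forall i t, `|G1 i t| <= M) ->
    exists M : R, forall i t, `|F1 i t - G1 i t| <= M.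
  move=> [M hM] [K hK]; exists (M + K) => i t.
  by rewrite (le_trans (ler_normB _ _))// lerD.
elim: n F G => [|n IH] F G [bF HF] [bG HG]; (split; first exact: bnd) => //.
case: HF => F' [dF sF]; case: HG => G' [dG sG].
exists (fun i t => F' i t - G' i t); split; last exact: IH.
by move=> i t; exact: is_deriveB.
Qed.

Lemma unif_smoothM n F G : unif_smooth n F -> unif_smooth n G ->
  unif_smooth n (fun i t => F i t * G i t).
Proof.
have bnd F1 G1 : (exists M : R, forall i t, `|F1 i t| <= M) ->
    (exists M : R, forall i t, `|G1 i t| <= M) ->
    exists M : R, forall i t, `|F1 i t * G1 i t| <= M.
  by move=> [M hM] [K hK]; exists (M * K) => i t; rewrite normrM ler_pM.
elim: n F G => [|n IH] F G [bF HF] [bG HG]; (split; first exact: bnd) => //.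
case: HF => F' [dF sF]; case: HG => G' [dG sG].
exists (fun i t => F i t * G' i t - - G i t * F' i t); split.
  move=> i t; have := is_deriveM (dF i t) (dG i t).
  by rewrite !mulNr opprK.
apply: unif_smoothB; first by apply: IH => //; apply: unif_smoothW; split=> //; exists F'.
apply: IH => //.
have sG0 : unif_smooth n G by apply: unif_smoothW; split=> //; exists G'.
have -> : (fun i t => - G i t) = (fun i t => 0 - G i t).
  by apply/funext => i; apply/funext => t; rewrite sub0r.
apply: unif_smoothB => //.
(* the zero function is smooth to every order *)
elim: (n) => [|k IHk]; split => //; try by exists 0 => *; rewrite normr0.
by exists (fun _ _ => 0); split => // i t; exact: is_derive_cst.
Qed.

Lemma le_of_derive_le (f f' : R -> R) (M : R) (n : nat) :
  0 <= M ->
  (forall t : R, is_derive t 1 f (f' t)) -> f 0 = 0 ->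
  (forall t, `|f' t| <= M * `|t| ^+ n) ->
  forall t, `|f t| <= M * `|t| ^+ n.+1.
Proof.
move=> M0 df f0 bf' t.
have cf a b : {within `[a, b], continuous f}.
  apply: continuous_subspaceT => x.
  by apply: differentiable_continuous; apply/derivable1_diffP; case: (df x).
have key c : `|c| <= `|t| -> `|f' c * t| <= M * `|t| ^+ n.+1.
  move=> ct; rewrite normrM exprSr mulrA ler_wpM2r//.
  by rewrite (le_trans (bf' c))// ler_wpM2l// lerXn2r// nnegrE.
have [t0|t0] := leP 0 t.
  have [c] := MVT_segment t0 (fun x _ => df x) (cf 0 t).
  rewrite in_itv/= f0 !subr0 => /andP[c0 ct] ->; apply: key.
  by rewrite !ger0_norm.
have [c] := MVT_segment (ltW t0) (fun x _ => df x) (cf t 0).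
rewrite in_itv/= f0 !sub0r => /andP[tc c0]; rewrite mulrN => /oppr_inj ->.
by apply: key; rewrite !ler0_norm// ?lerN2// ltW.
Qed.

(** Integrating the expansion of the derivative.  The mean value theorem replaces
    the usual factorials by a constant, which only has to be uniform. *)
Lemma unif_taylor n F : unif_smooth n F ->
  exists (c : nat -> I -> R) (M : R), 0 <= M /\
    (forall k i, (k < n)%N -> `|c k i| <= M) /\
    forall i t, `|F i t - \sum_(k < n) c k i * t ^+ k| <= M * `|t| ^+ n.
Proof.
elim: n F => [|n IH] F [[K bF] HF].
  exists (fun _ _ => 0), `|K|; split => //; split => // i t.
  by rewrite big_ord0 subr0 expr0 mulr1 (le_trans (bF i t))// ler_norm.
case: HF => F' [dF /IH[c [M [M0 [cM hM]]]]].
exists (fun k i => if k is j.+1 then c j i / j.+1%:R else F i 0).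
exists (M + `|K|); split; first by rewrite addr_ge0.
split.
  move=> [|k] i kn.
    by rewrite (le_trans (bF i 0))// (le_trans (ler_norm _))// lerDr.
  rewrite normrM normfV normr_nat ler_pdivrMr ?ltr0n//.
  have cki := cM k i kn; rewrite (le_trans cki)//.
  by rewrite -[leLHS]mulr1 ler_pM// ?lerDl// ler1n.
move=> i t.
apply: (@le_trans _ _ (M * `|t| ^+ n.+1)); last first.
  by rewrite ler_wpM2r ?exprn_ge0// lerDl.
pose f (t : R) := F i t - F i 0 - \sum_(k < n) c k i / k.+1%:R * t ^+ k.+1.
have -> : F i t - \sum_(k < n.+1)
    (if val k is j.+1 then c j i / j.+1%:R else F i 0) * t ^+ k = f t.
  by rewrite /f big_ord_recl /= expr0 mulr1 opprD addrA.
have := @le_of_derive_le f (fun t => F' i t - 0 - \sum_(k < n) c k i * t ^+ k) M n M0.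
apply.
- move=> x; apply: is_deriveB.
  apply: is_derive_big_sum => k.
  have := is_derive_monomial (c k i / k.+1%:R) x k.
  by rewrite divfK// pnatr_eq0.
- rewrite /f subrr sub0r big1 ?oppr0// => k _.
  by rewrite expr0n mulr0.
- by move=> x; rewrite subr0; exact: hM.
Qed.

(** One derivative more than the order of the polynomial gives a remainder that
    is [o(|t|^m)] near [0], yet is integrable as soon as [|t|^m] is: for
    [1 <= |t|], the function is bounded and every monomial is at most [|t|^m]. *)
Lemma unif_taylor_min m F : unif_smooth m.+1 F ->
  exists (c : nat -> I -> R) (C : R), 0 <= C /\
    forall i t, `|F i t - \sum_(k < m.+1) c k i * t ^+ k|
                <= C * (`|t| ^+ m * Num.min 1 `|t|).
Proof.
move=> sF; have [K bF] := unif_smooth_bounded sF.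
have [c [M [M0 [cM hM]]]] := unif_taylor sF.
have C0 : 0 <= M + (`|K| + m.+1%:R * M) by rewrite !addr_ge0// mulr_ge0.
exists c, (M + (`|K| + m.+1%:R * M)); split=> // i t.
have [t1|t1] := leP 1 `|t|; last first.
  rewrite -exprSr (le_trans (hM i t))// ler_wpM2r ?exprn_ge0//.
  by rewrite lerDl addr_ge0// mulr_ge0.
rewrite mulr1 mulrDl -[leLHS]add0r lerD ?mulr_ge0 ?exprn_ge0//.
rewrite mulrDl (le_trans (ler_normB _ _))// lerD//.
  rewrite (le_trans (bF i t))// (le_trans (ler_norm _))// ler_peMr//.
  by rewrite exprn_ege1.
rewrite (le_trans (ler_norm_sum _ _ _))//.
rewrite -mulrA mulr_natl -[X in _ *+ X]card_ord -sumr_const ler_sum// => k _.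
rewrite normrM ler_pM// ?cM// normrX ler_weXn2l//.
by rewrite -ltnS.
Qed.

End uniformly_smooth.

(** * Exponentially tilted averages and the Gibbs measure *)

(** [tilt_avg d f t] is the mean of [f] for the weights
    [exp (weight + t * dir)].  The state space carries a point, which keeps the
    normalisation positive. *)
Record tilt_data (R : realType) (K : R) := TiltData {
  tilt_state : finType;
  tilt_point : tilt_state;
  tilt_weight : tilt_state -> R;
  tilt_dir : tilt_state -> R;
  tilt_dir_le : forall i, `|tilt_dir i| <= K }.

Section tilt_avg.
Variables (R : realType) (K : R).
Local Notation D := (tilt_data K).

Definition tilt_exp (d : D) (t : R) (i : tilt_state d) : R :=
  expR (tilt_weight i + t * tilt_dir i).

Definition tilt_sum (d : D) (f : tilt_state d -> R) (t : R) : R :=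
  \sum_i f i * tilt_exp t i.

Definition tilt_avg (d : D) (f : tilt_state d -> R) (t : R) : R :=
  tilt_sum f t / @tilt_sum d (fun=> 1) t.

Lemma tilt_sum1_gt0 (d : D) t : 0 < tilt_sum (fun _ : tilt_state d => 1) t.
Proof.
rewrite /tilt_sum (bigD1 (tilt_point d))//= mul1r ltr_pwDl ?expR_gt0//.
by apply: sumr_ge0 => i _; rewrite mul1r expR_ge0.
Qed.

Lemma tilt_avg_le (d : D) (f : tilt_state d -> R) M t :
  (forall i, `|f i| <= M) -> `|tilt_avg f t| <= M.
Proof.
move=> fM; have Z0 := tilt_sum1_gt0 d t.
rewrite normrM normfV (gtr0_norm Z0) ler_pdivrMr// (le_trans (ler_norm_sum _ _ _))//.
rewrite /tilt_sum mulr_sumr ler_sum// => i _.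
by rewrite normrM mul1r [`|tilt_exp t i|]ger0_norm ?expR_ge0// ler_wpM2r// expR_ge0.
Qed.

Lemma is_derive_tilt_sum (d : D) (f : tilt_state d -> R) (t : R) :
  is_derive t 1 (tilt_sum f) (tilt_sum (fun i => f i * tilt_dir i) t).
Proof.
apply: is_derive_big_sum => i.
have := is_deriveZ (f i) (is_derive_expR_affine (tilt_weight i) (tilt_dir i) t).
by rewrite /GRing.scale/= mulrA.
Qed.

(** The truncated correlation of [f] and the direction; being again made of
    tilted averages of bounded functions, it can be differentiated indefinitely. *)
Lemma is_derive_tilt_avg (d : D) (f : tilt_state d -> R) (t : R) :
  is_derive t 1 (tilt_avg f)
    (tilt_avg (fun i => f i * tilt_dir i) t - tilt_avg f t * tilt_avg (@tilt_dir _ _ d) t).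
Proof.
have Z0 := lt0r_neq0 (tilt_sum1_gt0 d t).
have dZ := is_derive_tilt_sum (fun _ : tilt_state d => 1) t.
have dV := is_deriveV Z0 dZ.
have := is_deriveM (is_derive_tilt_sum f t) dV.
set l := (X in is_derive _ _ _ X -> _); set r := (X in _ -> is_derive _ _ _ X).
suff -> : l = r by [].
rewrite {}/l {}/r /GRing.scale/= /tilt_avg.
rewrite (_ : tilt_sum (fun i => 1 * _) t = tilt_sum (@tilt_dir _ _ d) t); last first.
  by apply: eq_bigr => i _; rewrite mul1r.
by field.
Qed.

(** The uniform bounds propagate from one derivative to the next because each
    differentiation multiplies the averaged functions by [tilt_dir], bounded by [K]. *)
Lemma unif_smooth_tilt_avg (J : Type) (d : J -> D) n
    (f : forall j, tilt_state (d j) -> R) :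
  (exists M : R, forall j i, `|f j i| <= M) ->
  unif_smooth n (fun j => tilt_avg (f j)).
Proof.
have bnd (g : forall j, tilt_state (d j) -> R) :
    (exists M : R, forall j i, `|g j i| <= M) ->
    exists M : R, forall j t, `|tilt_avg (g j) t| <= M.
  by move=> [M gM]; exists M => j t; exact: tilt_avg_le.
elim: n f => [|n IH] f fM; (split; first exact: bnd) => //.
exists (fun j t => tilt_avg (fun i => f j i * tilt_dir i) t -
                   tilt_avg (f j) t * tilt_avg (@tilt_dir _ _ (d j)) t); split.
  by move=> j t; exact: is_derive_tilt_avg.
apply: unif_smoothB.
  apply: IH; case: fM => M fM; exists (M * K) => j i.
  by rewrite normrM ler_pM// tilt_dir_le.
apply: unif_smoothM; first exact: IH.
by apply: IH; exists K => j i; exact: tilt_dir_le.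
Qed.

End tilt_avg.

Section gibbs_tilt.
Variables (R : realType).

(** Everything that the bounds must be uniform in, the size included. *)
Record gibbs_data := GibbsData {
  gd_N : nat;
  gd_X : config gd_N -> R;
  gd_e : config gd_N -> R;
  gd_e_le : forall s, `|gd_e s| <= 1;
  gd_f : config gd_N -> config gd_N -> config gd_N -> R;
  gd_f_le : forall s1 s2 s3, `|gd_f s1 s2 s3| <= 1 }.

Lemma three_replica_dir_le (g : gibbs_data)
    (s : config (gd_N g) * config (gd_N g) * config (gd_N g)) :
  `|gd_e s.1.1 + gd_e s.1.2 + gd_e s.2| <= 3.
Proof.
have -> : 3 = 1 + 1 + 1 :> R by ring.
do 2 (rewrite (le_trans (ler_normD _ _))// lerD ?gd_e_le//).
Qed.

(** The product of the three Gibbs weights is a single exponential weight on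
    triples, whose direction [e s1 + e s2 + e s3] is bounded by [3]. *)
Definition three_replicas (g : gibbs_data) : tilt_data 3 :=
  @TiltData R 3 (config (gd_N g) * config (gd_N g) * config (gd_N g))%type
    ([ffun=> false], [ffun=> false], [ffun=> false])
    (fun s => gd_X s.1.1 + gd_X s.1.2 + gd_X s.2)
    (fun s => gd_e s.1.1 + gd_e s.1.2 + gd_e s.2)
    (@three_replica_dir_le g).

Lemma gibbs_avg3_tilt (g : gibbs_data) (t : R) :
  gibbs_avg3 (fun s => gd_X s + t * gd_e s) (@gd_f g) =
  @tilt_avg _ _ (three_replicas g) (fun s => gd_f s.1.1 s.1.2 s.2) t.
Proof.
pose E (s : config (gd_N g)) := expR (gd_X s + t * gd_e s) : R.
pose Z := \sum_s E s.
have Eexp (s : tilt_state (three_replicas g)) :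
    tilt_exp t s = E s.1.1 * E s.1.2 * E s.2.
  by rewrite /E -!expRD /tilt_exp/=; congr expR; ring.
have Z3 : @tilt_sum _ _ (three_replicas g) (fun=> 1) t = Z * Z * Z.
  rewrite /Z big_distrlr/= pair_bigA/= big_distrlr/= pair_bigA/=.
  by apply: eq_bigr => s _; rewrite mul1r Eexp.
rewrite /tilt_avg Z3 /gibbs_avg3 /tilt_sum pair_bigA/=.
rewrite (pair_bigA _ (fun (p : config (gd_N g) * config (gd_N g)) s3 =>
  gibbs _ p.1 * gibbs _ p.2 * gibbs _ s3 * gd_f p.1 p.2 s3))/=.
rewrite mulr_suml; apply: eq_bigr => s _.
rewrite Eexp /gibbs -/Z -!/(E _).
by rewrite !invfM; ring.
Qed.

Lemma unif_smooth_gibbs n :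
  unif_smooth n (fun (g : gibbs_data) t =>
    gibbs_avg3 (fun s => gd_X s + t * gd_e s) (@gd_f g)).
Proof.
rewrite (_ : (fun g t => _) =
  fun g => @tilt_avg _ _ (three_replicas g) (fun s => gd_f s.1.1 s.1.2 s.2)).
  apply: (unif_smooth_tilt_avg n).
  by exists 1 => g s; exact: gd_f_le.
by apply/funext => g; apply/funext => t; exact: gibbs_avg3_tilt.
Qed.

End gibbs_tilt.

(** * Integrating out one independent variable *)

Section independent_pair.
Context d (T : measurableType d) (R : realType) (P : probability T R).
Variable G : set (set T).
Hypothesis mG : G `<=` measurable.
Hypothesis GT : G setT.
Hypothesis GI : setI_closed G.
Variable X : {RV P >-> R}.
Hypothesis XG : forall A B, measurable A -> G B ->
  P (X @^-1` A `&` B) = (P (X @^-1` A) * P B)%E.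

Local Notation TG := (g_sigma_algebraType G).

Lemma measurable_id_g_sigma_algebra : measurable_fun setT (id : T -> TG).
Proof.
move=> _ B mB; rewrite setTI preimage_id.
exact: (smallest_sub (@sigma_algebra_measurable _ T) mG).
Qed.

(** For fixed [A], both sides are finite measures in [B] that agree on the
    pi-system [G]. *)
Lemma independent_g_sigma (A : set R) (B : set T) : measurable A -> <<s G >> B ->
  P (X @^-1` A `&` B) = (P (X @^-1` A) * P B)%E.
Proof.
move=> mA sB.
have mXA : measurable (X @^-1` A) by exact: measurable_funPTI.
have r0 : 0 <= fine (P (X @^-1` A)) by exact: fine_ge0.
have rE : ((NngNum r0)%:num%:E = P (X @^-1` A))%E.
  by rewrite /= fineK// fin_num_measure.
pose m1 := mrestr P mXA.
pose m2 := mscale (NngNum r0) P.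
have H := @g_sigma_algebra_measure_unique _ R T G mG (fun=> setT) (fun=> GT) _
  m1 m2 GI _ _ B sB.
rewrite setIC -rE; apply: H => [|C GC|_].
- by rewrite bigcup_const.
- by rewrite /m1 /m2 /= /mrestr /mscale rE -XG// setIC.
- by rewrite /m1 /= /mrestr setTI -ge0_fin_numE// fin_num_measure.
Qed.

(** The law of [w |-> (X w, w)], with the second component seen through the
    sigma-algebra of [G] only, is a product measure; Tonelli then separates the
    two integrals. *)
Lemma ge0_integral_independent_pair (f : R * TG -> \bar R) :
  measurable_fun setT f -> (forall x, 0 <= f x)%E ->
  (\int[P]_w f (X w, w) =
   \int[distribution P X]_t \int[P]_w f (t, w))%E.
Proof.
move=> mf f0.
have mid := measurable_id_g_sigma_algebra.
have mpair : measurable_fun setT (fun w => (X w, w) : R * TG).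
  exact: measurable_fun_pair.
pose idG : {mfun T >-> TG} := HB.pack (id : T -> TG)
  (isMeasurableFun.Build _ _ _ _ _ mid).
pose XidG : {mfun T >-> (R * TG)%type} := HB.pack (fun w => (X w, w) : R * TG)
  (isMeasurableFun.Build _ _ _ _ _ mpair).
have law : forall C, measurable C ->
    (distribution P X \x distribution P idG)%E C = distribution P XidG C.
  apply: product_measure_unique => A B mA mB.
  exact: independent_g_sigma.
transitivity (\int[distribution P XidG]_z f z)%E.
  by rewrite ge0_integral_distribution.
transitivity (\int[distribution P X \x distribution P idG]_z f z)%E.
  by apply: eq_measure_integral => C mC _; apply: esym; exact: law.
rewrite fubini_tonelli1//; apply: eq_integral => t _.
rewrite /fubini_F ge0_integral_distribution//.
exact: measurableT_comp.
Qed.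

End independent_pair.

Section independent_family.
Context d (T : measurableType d) (R : realType) (P : probability T R).
Variables (I : eqType) (D : set I) (X : I -> {RV P >-> R}).
Hypothesis indX : independent_on D X.

(** The pi-system of events on which the product rule of independence speaks;
    it generates the sigma-algebra of the variables indexed by [J]. *)
Definition cylinders (J : seq I) : set (set T) :=
  [set B | exists2 A : I -> set R, (forall i, measurable (A i)) &
           B = \bigcap_(i in [set` J]) (X i @^-1` A i)].

Lemma cylindersT J : cylinders J setT.
Proof.
exists (fun=> setT) => //; apply/esym.
by rewrite -subTset => w _ i _.
Qed.

Lemma cylindersI J : setI_closed (cylinders J).
Proof.
move=> _ _ [A mA ->] [B mB ->]; exists (fun i => A i `&` B i).
  by move=> i; exact: measurableI.
by rewrite -bigcapI; apply: eq_bigcapr => i _; rewrite preimage_setI.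
Qed.

Lemma cylinders_measurable J : cylinders J `<=` measurable.
Proof.
move=> _ [A mA ->]; apply: fin_bigcap_measurable; first exact: finite_seq.
by move=> i _; exact: measurable_funPTI.
Qed.

Lemma measurable_coordinate J i : i \in J ->
  measurable_fun setT (X i : g_sigma_algebraType (cylinders J) -> R).
Proof.
move=> iJ _ A mA; rewrite setTI; apply: sub_sigma_algebra.
exists (fun j => if j == i then A else setT).
  by move=> j; case: ifP.
apply/seteqP; split=> w /=.
  by move=> Aw j _ /=; case: eqP => // ->.
by move/(_ i iJ); rewrite /= eqxx.
Qed.

Lemma independent_cylinder k J A B :
  uniq (k :: J) -> [set` k :: J] `<=` D -> measurable A -> cylinders J B ->
  P (X k @^-1` A `&` B) = (P (X k @^-1` A) * P B)%E.
Proof.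
move=> /= /andP[kJ uJ] JD mA [C mC ->].
pose A' i := if i == k then A else C i.
have mA' i : measurable (A' i) by rewrite /A'; case: ifP.
have nk i : i \in J -> A' i = C i.
  by move=> iJ; rewrite /A'; case: eqP => // ik; move: kJ; rewrite -ik iJ.
have -> : X k @^-1` A `&` \bigcap_(i in [set` J]) (X i @^-1` C i) =
    \bigcap_(i in [set` k :: J]) (X i @^-1` A' i).
  apply/seteqP; split=> w /=.
    move=> [Aw h] i /=; rewrite inE => /predU1P[->|iJ].
      by rewrite /A' eqxx.
    by rewrite nk//; exact: h.
  move=> h; split; first by have := h k (mem_head _ _); rewrite /= /A' eqxx.
  move=> i /= iJ; have := h i; rewrite /= nk// inE iJ orbT.
  exact.
rewrite (indX _ JD)//; last by rewrite /= kJ.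
rewrite big_cons {1}/A' eqxx (indX uJ)//.
  by congr (_ * _)%E; apply: eq_big_seq => i iJ; rewrite nk.
by move=> i iJ; apply: JD; rewrite /= inE iJ orbT.
Qed.

Lemma ge0_integral_independent_cons k J
    (f : R * g_sigma_algebraType (cylinders J) -> \bar R) :
  uniq (k :: J) -> [set` k :: J] `<=` D ->
  measurable_fun setT f -> (forall x, 0 <= f x)%E ->
  (\int[P]_w f (X k w, w) =
   \int[distribution P (X k)]_t \int[P]_w f (t, w))%E.
Proof.
move=> uJ JD mf f0; apply: ge0_integral_independent_pair => //.
- exact: cylinders_measurable.
- exact: cylindersT.
- exact: cylindersI.
- by move=> A B mA cB; exact: (@independent_cylinder k J).
Qed.

End independent_family.

(** * Integration of bounded functions *)

Lemma unit_bounded_integrable d (T : measurableType d) (R : realType)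
    (P : probability T R) (f : T -> R) :
  measurable_fun setT f -> (forall x, 0 <= f x <= 1) ->
  P.-integrable setT (EFin \o f).
Proof.
move=> mf f01; apply: (le_integrable measurableT (g := EFin \o cst 1)).
- exact/measurable_EFinP.
- move=> x _ /=; rewrite lee_fin normr1 ger0_norm; by case/andP: (f01 x).
- exact: finite_measure_integrable_cst.
Qed.

Lemma unit_bounded_Rintegral d (T : measurableType d) (R : realType)
    (P : probability T R) (f : T -> R) :
  measurable_fun setT f -> (forall x, 0 <= f x <= 1) ->
  ((\int[P]_x f x)%R%:E = \int[P]_x (f x)%:E)%E.
Proof.
move=> mf f01; rewrite /Rintegral fineK//.
exact: (integrable_fin_num measurableT (unit_bounded_integrable P mf f01)).
Qed.

Lemma Rintegral_cst_probability d (T : measurableType d) (R : realType)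
    (P : probability T R) (r : R) : \int[P]_x (cst r x) = r.
Proof.
rewrite Rintegral_cst// -[RHS]mulr1; congr (_ * _).
by transitivity (fine (1%E : \bar R)) => //; congr fine; exact: probability_setT.
Qed.

Lemma unit_bounded_Rintegral_bounds d (T : measurableType d) (R : realType)
    (P : probability T R) (f : T -> R) :
  measurable_fun setT f -> (forall x, 0 <= f x <= 1) ->
  0 <= \int[P]_x f x <= 1.
Proof.
move=> mf f01; apply/andP; split.
  by apply: Rintegral_ge0 => x _; case/andP: (f01 x).
rewrite -(Rintegral_cst_probability P 1).
apply: le_Rintegral => //.
- exact: unit_bounded_integrable.
- exact: finite_measure_integrable_cst.
- by move=> x _; case/andP: (f01 x).
Qed.

Lemma le_norm_RintegralB d (T : measurableType d) (R : realType)
    (P : probability T R) (f g : T -> R) (C : R) :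
  P.-integrable setT (EFin \o f) -> P.-integrable setT (EFin \o g) ->
  (forall x, `|f x - g x| <= C) ->
  `|\int[P]_x f x - \int[P]_x g x| <= C.
Proof.
move=> intf intg fgC.
have intfg : P.-integrable setT (EFin \o (fun x => f x - g x)).
  rewrite (_ : EFin \o _ = (EFin \o f) \- (EFin \o g))%E//.
  exact: integrableB.
rewrite -RintegralB// (le_trans (le_normr_Rintegral _ _))//.
rewrite -(Rintegral_cst_probability P C).
apply: le_Rintegral => //; last exact: finite_measure_integrable_cst.
exact: integrable_norm.
Qed.

Section change_of_variable.
Context d d' (T : measurableType d) (T' : measurableType d') (R : realType).
Variables (P : probability T R) (Y : {RV P >-> T'}) (f : T' -> R).
Hypothesis mf : measurable_fun setT f.

Lemma integrable_distribution :
  (distribution P Y).-integrable setT (EFin \o f) <->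
  P.-integrable setT (EFin \o (f \o Y)).
Proof.
have mEf : measurable_fun setT (EFin \o f) by exact/measurable_EFinP.
have absE : (\int[distribution P Y]_x `|(EFin \o f) x| =
    \int[P]_x `|(EFin \o (f \o Y)) x|)%E.
  by rewrite (ge0_integral_distribution Y)//; exact: measurableT_comp.
split=> /integrableP[_ fin]; apply/integrableP; split=> //.
- by apply/measurable_EFinP; exact: measurableT_comp.
- by rewrite -absE.
- by rewrite absE.
Qed.

Lemma integral_distribution_EFin :
  (distribution P Y).-integrable setT (EFin \o f) ->
  (\int[distribution P Y]_x (f x)%:E = \int[P]_x (f (Y x))%:E)%E.
Proof.
move=> /integrable_distribution intf.
by rewrite (integral_distribution (X := Y))//; exact/measurable_EFinP.
Qed.

End change_of_variable.

Lemma measurable_sum_seq d (U : measurableType d) (R : realType) (I : eqType)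
    (J : seq I) (h : I -> U -> R) :
  (forall i, i \in J -> measurable_fun setT (h i)) ->
  measurable_fun setT (fun u => \sum_(i <- J) h i u).
Proof.
elim: J => [|k J IH] mh; first by under eq_fun do rewrite big_nil; exact: measurable_cst.
under eq_fun do rewrite big_cons.
apply: measurable_funD; first by apply: mh; exact: mem_head.
by apply: IH => i iJ; apply: mh; rewrite inE iJ orbT.
Qed.

(** * Lindeberg replacement *)

(** [mPhi] states the Borel measurability of [Phi] without a sigma-algebra on the
    function space [S -> R]. *)
Section lindeberg.
Variables (R : realType) (S : Type) (Phi : (S -> R) -> R).
Hypothesis Phi01 : forall v, 0 <= Phi v <= 1.
Hypothesis mPhi : forall d (U : measurableType d) (H : U -> S -> R),
  (forall s, measurable_fun setT (fun u => H u s)) ->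
  measurable_fun setT (fun u => Phi (H u)).
Variables (I : eqType) (D : set I) (e : I -> S -> R).

Lemma Phi_ge0 v : 0 <= Phi v. Proof. by case/andP: (Phi01 v). Qed.

Definition perturb (v : S -> R) (J : seq I) (x : I -> R) (s : S) : R :=
  v s + \sum_(i <- J) x i * e i s.

Lemma perturb_cons v k J x :
  perturb v (k :: J) x = perturb (fun s => v s + x k * e k s) J x.
Proof. by apply/funext => s; rewrite /perturb big_cons addrA. Qed.

Lemma measurable_perturb d (U : measurableType d) (v : U -> S -> R) J
    (x : U -> I -> R) s :
  measurable_fun setT (fun u => v u s) ->
  (forall i, i \in J -> measurable_fun setT (fun u => x u i)) ->
  measurable_fun setT (fun u => perturb (v u) J (x u) s).
Proof.
move=> mv mx; apply: measurable_funD => //.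
apply: measurable_sum_seq => i iJ.
by apply: measurable_funM => //; exact: mx.
Qed.

Section one_sequence.
Context d (T : measurableType d) (P : probability T R) (X : I -> {RV P >-> R}).
Hypothesis indX : independent_on D X.

Definition mean_perturb (J : seq I) (v : S -> R) : R :=
  \int[P]_w Phi (perturb v J (fun i => X i w)).

Lemma measurable_Phi_perturb J v :
  measurable_fun setT (fun w => Phi (perturb v J (fun i => X i w))).
Proof. by apply: mPhi => s; exact: measurable_perturb. Qed.

Lemma measurable_Phi_perturb2 k J v :
  measurable_fun setT (fun z : R * T =>
    Phi (perturb (fun s => v s + z.1 * e k s) J (fun i => X i z.2))).
Proof.
apply: mPhi => s; apply: measurable_perturb => //.
  by apply: measurable_funD => //; apply: measurable_funM.
by move=> i _; apply: measurableT_comp.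
Qed.

Lemma measurable_mean_perturb k J v :
  measurable_fun setT (fun t : R => mean_perturb J (fun s => v s + t * e k s)).
Proof.
have mf := measurable_Phi_perturb2 k J v.
apply/measurable_EFinP.
rewrite (_ : _ \o _ = fubini_F P (fun z : R * T =>
  (Phi (perturb (fun s => v s + z.1 * e k s) J (fun i => X i z.2)))%:E)).
  apply: measurable_fun_fubini_tonelli_F; first exact/measurable_EFinP.
  by move=> z; rewrite lee_fin Phi_ge0.
apply/funext => t; rewrite /= unit_bounded_Rintegral//.
exact: measurable_Phi_perturb.
Qed.

Lemma mean_perturb01 J v : 0 <= mean_perturb J v <= 1.
Proof.
by apply: unit_bounded_Rintegral_bounds => //; exact: measurable_Phi_perturb.
Qed.

Variable mu : probability R R.
Hypothesis lawX : forall i, D i -> forall A, measurable A ->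
  distribution P (X i) A = mu A.

(** Averaging over the first variable last. *)
Lemma mean_perturb_cons k J v : uniq (k :: J) -> [set` k :: J] `<=` D ->
  mean_perturb (k :: J) v =
  \int[mu]_t mean_perturb J (fun s => v s + t * e k s).
Proof.
move=> uJ JD; have Dk : D k by apply: JD; rewrite /= mem_head.
congr fine.
transitivity (\int[distribution P (X k)]_t \int[P]_w
    (Phi (perturb (fun s => v s + t * e k s) J (fun i => X i w)))%:E)%E.
  rewrite -(@ge0_integral_independent_cons _ _ _ _ _ _ _ indX k J (fun z =>
    (Phi (perturb (fun s => v s + z.1 * e k s) J (fun i => X i z.2)))%:E))//.
  - by apply: eq_integral => w _; rewrite perturb_cons.
  - apply/measurable_EFinP/mPhi => s; apply: measurable_perturb.
      by apply: measurable_funD => //; apply: measurable_funM.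
    move=> i iJ; apply: measurableT_comp => //; exact: measurable_coordinate.
  - by move=> z; rewrite lee_fin Phi_ge0.
rewrite [LHS](eq_measure_integral mu); last first.
  by move=> A mA _; exact: lawX.
apply: eq_integral => t _; rewrite unit_bounded_Rintegral//.
exact: measurable_Phi_perturb.
Qed.

Lemma measurable_Phi_line k v :
  measurable_fun setT (fun t : R => Phi (fun s => v s + t * e k s)).
Proof.
by apply: mPhi => s; apply: measurable_funD => //; apply: measurable_funM.
Qed.

Lemma measurable_Rintegral_Phi_line (nu : probability R R) k J v :
  measurable_fun setT (fun w =>
    \int[nu]_t Phi (fun s => perturb v J (fun i => X i w) s + t * e k s)).
Proof.
have mf := measurable_Phi_perturb2 k J v.
apply/measurable_EFinP.
rewrite (_ : _ \o _ = fubini_G nu (fun z : R * T =>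
  (Phi (perturb (fun s => v s + z.1 * e k s) J (fun i => X i z.2)))%:E)).
  apply: measurable_fun_fubini_tonelli_G; first exact/measurable_EFinP.
  by move=> z; rewrite lee_fin Phi_ge0.
apply/funext => w; rewrite /= unit_bounded_Rintegral//; last exact: measurable_Phi_line.
apply: eq_integral => t _; congr (Phi _)%:E.
by apply/funext => s; rewrite /perturb/= addrAC.
Qed.

(** By Tonelli, the average over a single line can be taken first, all other
    variables being frozen: this is what lets the one-variable estimate be used
    pointwise. *)
Lemma Rintegral_mean_perturb (nu : probability R R) k J v :
  \int[nu]_t mean_perturb J (fun s => v s + t * e k s) =
  \int[P]_w \int[nu]_t
     Phi (fun s => perturb v J (fun i => X i w) s + t * e k s).
Proof.
have mf := measurable_Phi_perturb2 k J v.
pose f (z : R * T) := Phi (perturb (fun s => v s + z.1 * e k s) J (fun i => X i z.2)).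
have f01 z : 0 <= f z <= 1 by exact: Phi01.
have fE t w : f (t, w) = Phi (fun s => perturb v J (fun i => X i w) s + t * e k s).
  by congr Phi; apply/funext => s; rewrite /perturb/= addrAC.
congr fine.
transitivity (\int[nu]_t \int[P]_w (f (t, w))%:E)%E.
  apply: eq_integral => t _; rewrite unit_bounded_Rintegral//.
  exact: measurable_Phi_perturb.
transitivity (\int[P]_w \int[nu]_t (f (t, w))%:E)%E.
  apply: (fubini_tonelli (fun z => (f z)%:E)); first exact/measurable_EFinP.
  by move=> z; rewrite lee_fin; case/andP: (f01 z).
apply: eq_integral => w _.
rewrite -unit_bounded_Rintegral//; first by under eq_Rintegral do rewrite fE.
by apply: (measurable_comp (F := setT) (g := fun t : R => (t, w)) measurableT _ mf).
Qed.

End one_sequence.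

Section two_sequences.
Context d (T : measurableType d) (P : probability T R) (X : I -> {RV P >-> R}).
Context d' (T' : measurableType d') (P' : probability T' R) (X' : I -> {RV P' >-> R}).
Variables (mu nu : probability R R) (delta : I -> R).
Hypothesis indX : independent_on D X.
Hypothesis indX' : independent_on D X'.
Hypothesis lawX : forall i, D i -> forall A, measurable A ->
  distribution P (X i) A = mu A.
Hypothesis lawX' : forall i, D i -> forall A, measurable A ->
  distribution P' (X' i) A = nu A.
Hypothesis swap_one : forall k, D k -> forall v,
  `|\int[mu]_t Phi (fun s => v s + t * e k s) -
    \int[nu]_t Phi (fun s => v s + t * e k s)| <= delta k.

(** Uniformity in the starting point [v] carries the induction.  Changing the
    law of the first variable while the others follow [X'] costs [delta k], and
    changing the others while the first one follows [mu] is the induction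
    hypothesis averaged over [mu]. *)
Lemma lindeberg_replacement J v : uniq J -> [set` J] `<=` D ->
  `|mean_perturb X J v - mean_perturb X' J v| <= \sum_(k <- J) delta k.
Proof.
elim: J v => [|k J IH] v uJ JD.
  rewrite big_nil /mean_perturb.
  rewrite (_ : perturb v [::] = fun=> v); last first.
    by apply/funext => x; apply/funext => s; rewrite /perturb big_nil addr0.
  by rewrite !(Rintegral_cst_probability _ (Phi v)) subrr normr0.
have Dk : D k by apply: JD; rewrite /= mem_head.
have JD' : [set` J] `<=` D by move=> i iJ; apply: JD; rewrite /= inE iJ orbT.
have uJ' : uniq J by case/andP: uJ.
rewrite (mean_perturb_cons indX lawX)// (mean_perturb_cons indX' lawX')//.
set A := fun t : R => mean_perturb X J (fun s => v s + t * e k s).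
set B := fun t : R => mean_perturb X' J (fun s => v s + t * e k s).
have mA : measurable_fun setT A by exact: measurable_mean_perturb.
have mB : measurable_fun setT B by exact: measurable_mean_perturb.
have A01 t : 0 <= A t <= 1 by exact: mean_perturb01.
have B01 t : 0 <= B t <= 1 by exact: mean_perturb01.
rewrite big_cons [leRHS]addrC.
rewrite -(subrK (\int[mu]_t B t) (\int[mu]_t A t)) -addrA.
rewrite (le_trans (ler_normD _ _))// lerD//.
  apply: le_norm_RintegralB; [exact: unit_bounded_integrable..|].
  by move=> t; exact: IH.
rewrite !(Rintegral_mean_perturb X').
have mswap (m : probability R R) : measurable_fun setT (fun w =>
    \int[m]_t Phi (fun s => perturb v J (fun i => X' i w) s + t * e k s)).
  exact: measurable_Rintegral_Phi_line.
have swap01 (m : probability R R) w : 0 <=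
    \int[m]_t Phi (fun s => perturb v J (fun i => X' i w) s + t * e k s) <= 1.
  by apply: unit_bounded_Rintegral_bounds => //; exact: measurable_Phi_line.
apply: le_norm_RintegralB; [exact: unit_bounded_integrable..|].
by move=> w; exact: swap_one.
Qed.

End two_sequences.
End lindeberg.

(** * Exchanging one variable when moments match *)

(** The part of the Taylor remainder that depends on the law; it is finite under
    a moment of order [m], and vanishes with [a]. *)
Definition capped_moment (R : realType) (m : nat) (mu : probability R R) (a : R) : R :=
  \int[mu]_x (`|x| ^+ m * Num.min 1 (a * `|x|)).

Section moment_matching.
Variables (R : realType) (m : nat).

Lemma integrable_pow (mu : probability R R) k : (k <= m)%N ->
  mu.-integrable setT (EFin \o (fun x : R => `|x| ^+ m)) ->
  mu.-integrable setT (EFin \o (fun x : R => x ^+ k)).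
Proof.
move=> km im.
apply: (le_integrable measurableT (g := EFin \o (fun x : R => 1 + `|x| ^+ m))).
- by apply/measurable_EFinP; exact: exprn_measurable.
- move=> x _ /=; rewrite lee_fin normrX [leRHS]ger0_norm ?addr_ge0 ?exprn_ge0//.
  have [x1|x1] := leP `|x| 1.
    by rewrite (le_trans (exprn_ile1 _ _ _))// lerDl exprn_ge0.
  by rewrite (le_trans (ler_weXn2l (ltW x1) km))// lerDr.
- rewrite (_ : EFin \o _ = (EFin \o cst (1 : R)%R) \+ (EFin \o (fun x : R => `|x| ^+ m)%R))%E//.
  by apply: integrableD => //; exact: finite_measure_integrable_cst.
Qed.

Lemma measurable_capped a :
  measurable_fun setT (fun x : R => `|x| ^+ m * Num.min 1 (a * `|x|)).
Proof.
apply: measurable_funM; first by apply: measurable_funX; exact: normr_measurable.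
by apply: measurable_minr => //; apply: measurable_funM => //; exact: normr_measurable.
Qed.

Lemma integrable_capped (mu : probability R R) a : 0 <= a ->
  mu.-integrable setT (EFin \o (fun x : R => `|x| ^+ m)) ->
  mu.-integrable setT (EFin \o (fun x : R => `|x| ^+ m * Num.min 1 (a * `|x|))).
Proof.
move=> a0; apply: le_integrable => //.
  by apply/measurable_EFinP; exact: measurable_capped.
move=> x _ /=; rewrite lee_fin [leRHS]ger0_norm ?exprn_ge0//.
have m0 : 0 <= Num.min 1 (a * `|x|) by rewrite le_min ler01 mulr_ge0.
rewrite ger0_norm ?mulr_ge0 ?exprn_ge0// ler_piMr ?exprn_ge0//.
by rewrite ge_min lexx.
Qed.

Variables mu nu : probability R R.
Hypothesis imu : mu.-integrable setT (EFin \o (fun x : R => `|x| ^+ m)).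
Hypothesis inu : nu.-integrable setT (EFin \o (fun x : R => `|x| ^+ m)).
Hypothesis mom : forall k, (k <= m)%N -> \int[mu]_x (x ^+ k) = \int[nu]_x (x ^+ k).

Lemma integrable_poly (la : probability R R) (c : nat -> R) n : (n <= m.+1)%N ->
  la.-integrable setT (EFin \o (fun x : R => `|x| ^+ m)) ->
  la.-integrable setT (EFin \o (fun x : R => \sum_(k < n) c k * x ^+ k)).
Proof.
move=> nm ila; elim: n nm => [|n IH] nm.
  under eq_fun do rewrite big_ord0.
  exact: finite_measure_integrable_cst.
under eq_fun do rewrite big_ord_recr/=.
rewrite (_ : EFin \o _ = (EFin \o (fun x : R => \sum_(k < n) c k * x ^+ k)%R) \+
  (fun x => (c n)%:E * (EFin \o (fun x => x ^+ n)%R) x))%E//.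
apply: integrableD => //; first by apply: IH; exact: ltnW.
by apply: integrableZl => //; exact: integrable_pow.
Qed.

Lemma Rintegral_poly (la : probability R R) (c : nat -> R) n : (n <= m.+1)%N ->
  la.-integrable setT (EFin \o (fun x : R => `|x| ^+ m)) ->
  \int[la]_x (\sum_(k < n) c k * x ^+ k) = \sum_(k < n) c k * \int[la]_x (x ^+ k).
Proof.
move=> nm ila; elim: n nm => [|n IH] nm.
  under eq_Rintegral do rewrite big_ord0.
  by rewrite big_ord0 (Rintegral_cst_probability la 0).
under eq_Rintegral do rewrite big_ord_recr/=.
have ipow := integrable_pow nm ila.
rewrite RintegralD//; last 2 first.
- by apply: integrable_poly => //; exact: ltnW.
- rewrite (_ : EFin \o _ = (fun x => (c n)%:E * (EFin \o (fun x => x ^+ n)%R) x))%E//.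
  exact: integrableZl.
by rewrite big_ord_recr/= RintegralZl// IH// ltnW.
Qed.

(** The two integrals of the Taylor polynomial coincide, as it only involves
    the common moments. *)
Lemma moment_matching_swap (phi : R -> R) (c : nat -> R) (C a : R) :
  0 <= a ->
  measurable_fun setT phi -> (forall t, 0 <= phi t <= 1) ->
  (forall t, `|phi t - \sum_(k < m.+1) c k * t ^+ k| <=
     C * (`|t| ^+ m * Num.min 1 (a * `|t|))) ->
  `|\int[mu]_t phi t - \int[nu]_t phi t| <=
    C * (capped_moment m mu a + capped_moment m nu a).
Proof.
move=> a0 mphi phi01 hphi.
have main (la : probability R R) :
    la.-integrable setT (EFin \o (fun x : R => `|x| ^+ m)) ->
    `|\int[la]_t phi t - \int[la]_t (\sum_(k < m.+1) c k * t ^+ k)| <=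
    C * capped_moment m la a.
  move=> ila.
  have ip := integrable_poly c (leqnn _) ila.
  have iphi := unit_bounded_integrable la mphi phi01.
  have id : la.-integrable setT (EFin \o (fun t => phi t - \sum_(k < m.+1) c k * t ^+ k)).
    rewrite (_ : EFin \o _ = (EFin \o phi) \-
      (EFin \o (fun t => \sum_(k < m.+1) c k * t ^+ k)%R))%E//.
    exact: integrableB.
  rewrite -RintegralB// (le_trans (le_normr_Rintegral _ _))//.
  rewrite /capped_moment -RintegralZl//; last exact: integrable_capped.
  apply: le_Rintegral => //; first exact: integrable_norm.
  rewrite (_ : EFin \o _ = (fun x => C%:E * (EFin \o (fun t => `|t| ^+ m * Num.min 1 (a * `|t|))%R) x))%E//.
  by apply: integrableZl => //; exact: integrable_capped.
have E : \int[mu]_t (\sum_(k < m.+1) c k * t ^+ k) =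
         \int[nu]_t (\sum_(k < m.+1) c k * t ^+ k).
  rewrite !Rintegral_poly//; apply: eq_bigr => k _.
  by rewrite mom// -ltnS.
have := main mu imu; have := main nu inu.
rewrite -E mulrDr distrC => h2 h1.
by rewrite -(subrK (\int[mu]_t (\sum_(k < m.+1) c k * t ^+ k)) (\int[mu]_t phi t))
  -addrA (le_trans (ler_normD _ _))// lerD.
Qed.

End moment_matching.

Lemma gibbs_avg3_bounds (R : realType) N (X : config N -> R) f :
  (forall s1 s2 s3, 0 <= f s1 s2 s3 <= 1) -> 0 <= gibbs_avg3 X f <= 1.
Proof.
move=> f01.
have Z0 : 0 < \sum_(s' : config N) expR (X s').
  rewrite (bigD1 [ffun=> false])//=; apply: ltr_pwDl; first exact: expR_gt0.
  by apply: sumr_ge0 => s _; exact: expR_ge0.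
have G0 s : 0 <= gibbs X s by rewrite divr_ge0 ?expR_ge0// ltW.
have G1 : \sum_s gibbs X s = 1 by rewrite -mulr_suml divff// gt_eqF.
apply/andP; split.
  apply: sumr_ge0 => s1 _; apply: sumr_ge0 => s2 _; apply: sumr_ge0 => s3 _.
  have [f0 _] := andP (f01 s1 s2 s3).
  by do 3 apply: mulr_ge0 => //.
have <- : \sum_s1 \sum_s2 \sum_s3 gibbs X s1 * gibbs X s2 * gibbs X s3 = 1.
  under eq_bigr do under eq_bigr do rewrite -mulr_sumr G1 mulr1.
  by under eq_bigr do rewrite -mulr_sumr G1 mulr1.
apply: ler_sum => s1 _; apply: ler_sum => s2 _; apply: ler_sum => s3 _.
have [_ f1] := andP (f01 s1 s2 s3).
by apply: ler_piMr => //; do 2 apply: mulr_ge0 => //.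
Qed.

Lemma measurable_gibbs_avg3 (R : realType) N f d (U : measurableType d)
    (H : U -> config N -> R) :
  (forall s, measurable_fun setT (fun u => H u s)) ->
  measurable_fun setT (fun u => gibbs_avg3 (H u) f).
Proof.
move=> mH.
have mE s : measurable_fun setT (fun u => expR (H u s)) by exact: measurableT_comp.
have mG s : measurable_fun setT (fun u => gibbs (H u) s).
  rewrite /gibbs (_ : (fun u => _) = fun u => expR (H u s) *
      (\sum_s' expR (H u s')) `^ (-1)).
    apply: measurable_funM => //.
    (* the inverse of a positive number is its power -1, which is measurable *)
    apply: (measurableT_comp (measurable_powR _)).
    exact: measurable_sum.
  apply/funext => u; rewrite powR_inv1//.
  by apply: sumr_ge0 => s' _; exact: expR_ge0.
rewrite /gibbs_avg3.
apply: measurable_sum => s1; apply: measurable_sum => s2; apply: measurable_sum => s3.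
apply: measurable_funM => //; apply: measurable_funM => //; exact: measurable_funM.
Qed.

(** The expansion is taken in the variable [a * t], whence the factor [a ^+ m];
    the constant depends on [m] only. *)
Lemma gibbs_swap (R : realType) m : exists2 C : R, 0 <= C &
  forall (mu nu : probability R R) N (X : config N -> R) e f a,
  mu.-integrable setT (EFin \o (fun x : R => `|x| ^+ m)) ->
  nu.-integrable setT (EFin \o (fun x : R => `|x| ^+ m)) ->
  (forall k, (k <= m)%N -> \int[mu]_x (x ^+ k) = \int[nu]_x (x ^+ k)) ->
  0 <= a -> (forall s, `|e s| <= 1) -> (forall s1 s2 s3, 0 <= f s1 s2 s3 <= 1) ->
  `|\int[mu]_t gibbs_avg3 (fun s => X s + t * (a * e s)) f -
    \int[nu]_t gibbs_avg3 (fun s => X s + t * (a * e s)) f| <=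
  C * (a ^+ m * (capped_moment m mu a + capped_moment m nu a)).
Proof.
have [c [C [C0 hC]]] := unif_taylor_min (@unif_smooth_gibbs R m.+1).
exists C => // mu nu N X e f a imu inu mom a0 e1 f01.
have f1 s1 s2 s3 : `|f s1 s2 s3| <= 1.
  by have /andP[? ?] := f01 s1 s2 s3; rewrite ger0_norm.
pose g := GibbsData X e1 f1.
rewrite mulrA; apply: (@moment_matching_swap _ _ _ _ _ _ _ _ (fun k => c k g * a ^+ k)) => //.
- apply: measurable_gibbs_avg3 => s; apply: measurable_funD => //.
  exact: measurable_funM.
- by move=> t; exact: gibbs_avg3_bounds.
- move=> t; have := hC g (a * t).
  rewrite normrM (ger0_norm a0) exprMn.
  rewrite (_ : gibbs_avg3 _ _ = gibbs_avg3 (fun s => X s + t * (a * e s)) f); last first.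
    by congr gibbs_avg3; apply/funext => s /=; ring.
  rewrite -!mulrA; under eq_bigr do rewrite exprMn mulrA.
  exact.
Qed.

(** * Second moments, and limits off a null set *)

Section second_moment.
Context d (T : measurableType d) (R : realType) (P : probability T R).
Variables (I : eqType) (D : set I) (X : I -> {RV P >-> R}) (mu : probability R R).
Hypothesis indX : independent_on D X.
Hypothesis lawX : forall i, D i -> forall A, measurable A ->
  distribution P (X i) A = mu A.
Hypothesis imu : mu.-integrable setT (EFin \o (fun x : R => `|x| ^+ 2)).
Hypothesis mu1 : \int[mu]_x (x ^+ 1) = 0.
Hypothesis mu2 : \int[mu]_x (x ^+ 2) = 1.

(** Orthogonality of independent centred variables.  The constant [c] is needed
    for the induction: integrating all variables but the first leaves a second
    degree polynomial in the latter. *)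
Lemma second_moment_sum J (b : I -> R) c : uniq J -> [set` J] `<=` D ->
  (\int[P]_w ((c + \sum_(i <- J) b i * X i w) ^+ 2)%:E =
   (c ^+ 2 + \sum_(i <- J) b i ^+ 2)%:E)%E.
Proof.
elim: J c => [|k J IH] c uJ JD.
  under eq_integral do rewrite big_nil addr0.
  rewrite big_nil addr0 integral_cst//.
  rewrite -[RHS]mule1; congr (_ * _)%E; exact: probability_setT.
have Dk : D k by apply: JD; rewrite /= mem_head.
have JD' : [set` J] `<=` D by move=> i iJ; apply: JD; rewrite /= inE iJ orbT.
have uJ' : uniq J by case/andP: uJ.
transitivity (\int[distribution P (X k)]_t \int[P]_w
    (((c + b k * t) + \sum_(i <- J) b i * X i w) ^+ 2)%:E)%E.
  rewrite -(@ge0_integral_independent_cons _ _ _ _ _ _ _ indX k J (fun z =>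
    (((c + b k * z.1) + \sum_(i <- J) b i * X i z.2) ^+ 2)%:E))//.
  - by apply: eq_integral => w _; rewrite big_cons addrA.
  - apply/measurable_EFinP; apply: measurable_funX; apply: measurable_funD.
      by apply: measurable_funD => //; apply: measurable_funM.
    apply: measurable_sum_seq => i iJ; apply: measurable_funM => //.
    by apply: measurableT_comp => //; exact: measurable_coordinate.
  - by move=> z; rewrite lee_fin sqr_ge0.
rewrite [LHS](eq_measure_integral mu); last by move=> A mA _; exact: lawX.
under eq_integral do rewrite IH//.
set v := \sum_(i <- J) b i ^+ 2.
pose q (j : nat) : R :=
  if j is 0 then c ^+ 2 + v else if j is 1 then c * b k *+ 2 else b k ^+ 2.
have qE t : (c + b k * t) ^+ 2 + v = \sum_(j < 3) q j * t ^+ j.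
  by rewrite !big_ord_recr big_ord0/= /q; ring.
under eq_integral do rewrite qE.
have iq := @integrable_poly _ 2 mu q 3 (leqnn _) imu.
rewrite -[LHS]fineK ?integrable_fin_num//; congr EFin.
rewrite -[LHS]/(\int[mu]_t (\sum_(j < 3) q j * t ^+ j)).
rewrite (@Rintegral_poly _ 2 mu q 3 (leqnn _) imu).
rewrite !big_ord_recr big_ord0/= mu1 mu2 add0r mulr0 addr0 mulr1.
under eq_Rintegral do rewrite expr0.
by rewrite (Rintegral_cst_probability mu 1) /q big_cons -/v; ring.
Qed.

End second_moment.

Section null_set.
Context d (T : measurableType d) (R : realType) (mu : {measure set T -> \bar R}).
Local Open Scope ereal_scope.
Import HBNNSimple.

(** The integral of a nonnegative function is a supremum over simple functions
    below it, and restricting a simple function to the complement of [N] does not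
    change its integral. *)
Lemma ge0_integral_le_off_null (N : set T) (f g : T -> \bar R) :
  measurable N -> mu N = 0 -> (forall x, 0 <= f x) -> (forall x, 0 <= g x) ->
  (forall x, ~ N x -> f x <= g x) ->
  \int[mu]_x f x <= \int[mu]_x g x.
Proof.
move=> mN N0 f0 g0 fg.
rewrite !ge0_integralTE//.
apply: ub_ereal_sup => _ [h /= hf <-].
have mNC : measurable (~` N) by exact: measurableC.
apply: (@le_trans _ _ (sintegral mu (proj_nnsfun h mNC))).
  rewrite -!integralT_nnsfun (ge0_negligible_integral mN)//; last first.
  - by move=> x _; rewrite lee_fin.
  - exact/measurable_EFinP.
  rewrite setTD integral_mkcond le_eqVlt; apply/orP; left; apply/eqP.
  apply: eq_integral => x _; rewrite /patch /= mindicE.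
  by case: ifP => _; rewrite ?mulr1 ?mulr0.
apply: ereal_sup_ubound; exists (proj_nnsfun h mNC) => //= x.
rewrite mindicE; have [xN|xN] := pselect (N x).
  by rewrite memNset// mulr0 g0.
by rewrite mem_set//= mulr1 (le_trans (hf x))// fg.
Qed.

End null_set.

Lemma cvg_le_bound (R : realType) (u : nat -> R) (l M : R) :
  u n @[n --> \oo] --> l -> (forall n, u n <= M) -> l <= M.
Proof.
move=> ul uM; rewrite -(cvg_lim (@Rhausdorff R) ul); apply: limr_le.
  by apply/cvg_ex; exists l.
exact: nearW.
Qed.

Section bounded_ae_convergence.
Context d (T : measurableType d) (R : realType) (P : probability T R).

(** The values of [f] on the exceptional set are arbitrary.  For the Gibbs average
    they come from the limit of a divergent series, so [f] is compared to the
    everywhere limit of the [u n] cut off on that set. *)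
Lemma bounded_ae_cvg_integral (u : nat -> T -> R) (f : T -> R) :
  (forall n, measurable_fun setT (u n)) ->
  (forall n x, 0 <= u n x <= 1) -> (forall x, 0 <= f x) ->
  {ae P, forall x, u n x @[n --> \oo] --> f x} ->
  (\int[P]_x u n x)%R @[n --> \oo] --> fine (\int[P]_x (f x)%:E)%E /\
  (\int[P]_x (f x)%:E)%E \is a fin_num.
Proof.
move=> mu u01 f0 [N [mN N0 uN]].
pose v n x := u n x * \1_(~` N) x; pose g x := f x * \1_(~` N) x.
have offN (h : T -> R) x : ~ N x -> h x * \1_(~` N) x = h x.
  by move=> nx; rewrite indicE mem_set// mulr1.
have onN (h : T -> R) x : N x -> h x * \1_(~` N) x = 0.
  by move=> nx; rewrite indicE memNset ?mulr0//; exact.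
have ge0M (h : T -> R) x : 0 <= h x -> 0 <= h x * \1_(~` N) x.
  by move=> h0; rewrite mulr_ge0// indicE ler0n.
have eqN (h : T -> R) : (forall x, 0 <= h x) ->
    (\int[P]_x (h x)%:E = \int[P]_x (h x * \1_(~` N) x)%:E)%E.
  move=> h0; apply/eqP; rewrite eq_le; apply/andP; split;
    apply: (ge0_integral_le_off_null mN N0) => x; rewrite ?lee_fin ?h0 ?ge0M//;
    by move=> nx; rewrite offN.
have mv n : measurable_fun setT (v n).
  by apply: measurable_funM => //; apply: measurable_indic; exact: measurableC.
have vg x : v n x @[n --> \oo] --> g x.
  have [xN|xN] := pselect (N x).
    rewrite /g onN//; under eq_cvg do rewrite /v onN//; exact: cvg_cst.
  rewrite /g offN//; under eq_cvg do rewrite /v offN//.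
  by apply: contrapT => h; apply: xN; exact: uN.
have mg : measurable_fun setT g by exact: (measurable_fun_cvg mv).
have v01 n x : 0 <= v n x <= 1.
  have /andP[u0 u1] := u01 n x.
  by rewrite ge0M//= /v indicE; case: (_ \in _); rewrite ?mulr1 ?mulr0.
have g01 x : 0 <= g x <= 1.
  apply/andP; split; first exact: ge0M.
  by apply: (cvg_le_bound (vg x)) => n; case/andP: (v01 n x).
have gE : (\int[P]_x (f x)%:E = (\int[P]_x g x)%:E)%E.
  by rewrite eqN// -unit_bounded_Rintegral.
rewrite gE; split=> //=.
have uE n : \int[P]_x u n x = \int[P]_x v n x.
  rewrite /Rintegral eqN//; first by move=> x; case/andP: (u01 n x).
under eq_cvg do rewrite uE.
have ae1 : {ae P, forall x, setT x -> (v n x)%:E @[n --> \oo] --> (g x)%:E}.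
  apply: aeW => x _; apply: cvg_EFin; last exact: vg.
  exact: nearW.
have ae2 : {ae P, forall x n, setT x -> (`|(v n x)%:E| <= (EFin \o cst (1 : R)%R) x)%E}.
  apply: aeW => x n _ /=; rewrite lee_fin.
  by have /andP[v0 v1] := v01 n x; rewrite ger0_norm.
have mEv n : measurable_fun setT (fun x => (v n x)%:E) by exact/measurable_EFinP.
have mEg : measurable_fun setT (fun x => (g x)%:E) by exact/measurable_EFinP.
have [_ _ cv] := dominated_convergence measurableT mEv mEg ae1
  (finite_measure_integrable_cst P 1 measurableT) ae2.
apply: (@fine_cvg _ _ _ _ (fun n => \int[P]_x (v n x)%:E)%E).
by rewrite unit_bounded_Rintegral.
Qed.

End bounded_ae_convergence.

(** * Moments of the standard normal law *)

Section normal_moments.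
Variable R : realType.
Local Notation lam := (@lebesgue_measure R).
Local Notation TR := (measurableTypeR R).
Local Notation gam := (normal_prob (0 : R) 1).

(** A Radon-Nikodym derivative is determined almost everywhere by the measure. *)
Lemma ae_eq_normal_density :
  ae_eq lam setT (Radon_Nikodym_SigmaFinite.f gam lam)
    (fun x => (normal_pdf 0 1 x)%:E).
Proof.
have dom := @normal_prob_dominates R 0 1.
apply: integral_ae_eq => //.
- exact: Radon_Nikodym_SigmaFinite.f_integrable.
- by apply/measurable_EFinP; exact: measurable_normal_pdf.
- by move=> E _ mE; rewrite -Radon_Nikodym_SigmaFinite.f_integral.
Qed.

Lemma ge0_integral_normal (f : TR -> \bar R) :
  measurable_fun setT f -> (forall x, 0 <= f x)%E ->
  (\int[gam]_x f x = \int[lam]_x (f x * (normal_pdf 0 1 x)%:E))%E.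
Proof.
move=> mf f0; have dom := @normal_prob_dominates R 0 1.
rewrite -(Radon_Nikodym_SigmaFinite.change_of_variables dom f0 measurableT mf).
apply: ae_eq_integral => //.
- apply: emeasurable_funM => //.
  exact: measurable_int (Radon_Nikodym_SigmaFinite.f_integrable dom).
- apply: emeasurable_funM => //.
  by apply/measurable_EFinP; exact: measurable_normal_pdf.
- apply: ae_eqe_mul2l; exact: ae_eq_normal_density.
Qed.

Lemma integral_normal (f : TR -> \bar R) : gam.-integrable setT f ->
  (\int[gam]_x f x = \int[lam]_x (f x * (normal_pdf 0 1 x)%:E))%E.
Proof.
move=> intf; have dom := @normal_prob_dominates R 0 1.
have mf : measurable_fun setT f by exact: measurable_int intf.
rewrite -(Radon_Nikodym_change_of_variables dom measurableT intf).
apply: ae_eq_integral => //.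
- apply: emeasurable_funM => //.
- apply: emeasurable_funM => //.
  by apply/measurable_EFinP; exact: measurable_normal_pdf.
- apply: ae_eqe_mul2l.
  apply: ae_eq_trans ae_eq_normal_density.
  by apply: ae_eq_sym; exact: ae_eq_Radon_Nikodym_SigmaFinite.
Qed.

Lemma normal_pdf01E x :
  normal_pdf 0 1 x = normal_peak 1 * expR (- 2^-1 * x ^+ 2) :> R.
Proof.
rewrite normal_pdfE ?oner_neq0//; congr (_ * expR _).
by rewrite subr0 expr1n mulrC mulrN mulNr.
Qed.

Lemma is_derive_normal_pdf (x : R) :
  is_derive x 1 (normal_pdf 0 1 : R -> R) (- x * normal_pdf 0 1 x).
Proof.
rewrite (_ : normal_pdf 0 1 = fun x => normal_peak 1 * expR (- 2^-1 * x ^+ 2) :> R); last first.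
  by apply/funext => y; exact: normal_pdf01E.
have h := is_derive_monomial (- 2^-1) x 1.
have := is_deriveZ (normal_peak 1) (@is_derive1_comp _ _
  (fun t : R => - 2^-1 * t ^+ 2) _ _ _ (is_derive_expR (- 2^-1 * x ^+ 2)) h).
set l := (X in is_derive _ _ _ X -> _); set r := (X in _ -> is_derive _ _ _ X).
suff -> : l = r by [].
by rewrite {}/l {}/r /GRing.scale/=; field.
Qed.

Lemma is_derive_id_normal_pdf (x : R) :
  is_derive x 1 (fun x : R => x * normal_pdf 0 1 x)
    ((1 - x ^+ 2) * normal_pdf 0 1 x).
Proof.
have := is_deriveM (is_derive_id x 1) (is_derive_normal_pdf x).
set l := (X in is_derive _ _ _ X -> _); set r := (X in _ -> is_derive _ _ _ X).
suff -> : l = r by [].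
by rewrite {}/l {}/r /GRing.scale/=; ring.
Qed.

(** [exp (3 x^2 / 8)] is the square of [exp (3 x^2 / 16)], hence at least
    [(3 x^2 / 16)^2]; and [-1/8 = 3/8 - 1/2]. *)
Lemma pow4_expR (x : R) : x ^+ 4 * expR (- 2^-1 * x ^+ 2) <=
  256 / 9 * expR (- 8^-1 * x ^+ 2).
Proof.
have h := expR_ge1Dx (3 / 16 * x ^+ 2).
have x2 := sqr_ge0 x.
have -> : expR (- 8^-1 * x ^+ 2) = expR (3 / 16 * x ^+ 2) ^+ 2 * expR (- 2^-1 * x ^+ 2).
  by rewrite -expRM_natl -expRD; congr expR; field.
rewrite (mulrA (256 / 9)) ler_wpM2r ?expR_ge0//.
move: h; set E := expR _; set z := x ^+ 2 in x2 * => hE.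
have -> : x ^+ 4 = z * z by rewrite /z -exprD.
nra.
Qed.

(** The integrand is dominated by a multiple of the normal density of standard
    deviation [2], whose integral is [1]. *)
Lemma integral_pow4_normal_lty : (\int[gam]_x (`|x : R| ^+ 4)%:E < +oo)%E.
Proof.
rewrite ge0_integral_normal; last 2 first.
- apply/measurable_EFinP; apply: measurable_funX; exact: normr_measurable.
- by move=> x; rewrite lee_fin exprn_ge0.
pose K : R := normal_peak 1 * (256 / 9) / normal_peak 2.
have p2 : 0 < normal_peak (2 : R) by exact: normal_peak_gt0.
have p1 := normal_peak_ge0 (1 : R).
have K0 : 0 <= K by rewrite !mulr_ge0// invr_ge0 ltW.
apply: (@le_lt_trans _ _ (\int[lam]_x (K%:E * (normal_pdf 0 2 x)%:E))%E).
  apply: ge0_le_integral => //.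
  - by move=> x _; rewrite -EFinM lee_fin mulr_ge0// ?normal_pdf_ge0// exprn_ge0.
  - apply/measurable_EFinP; apply: measurable_funM; last exact: measurable_normal_pdf.
    apply: measurable_funX; exact: normr_measurable.
  - apply/measurable_EFinP; apply: measurable_funM => //; exact: measurable_normal_pdf.
  - move=> x _; rewrite -!EFinM lee_fin normal_pdf01E normal_pdfE ?pnatr_eq0//.
    rewrite /normal_fun subr0 /K -normrX ger0_norm ?exprn_even_ge0//.
    rewrite (_ : - x ^+ 2 / _ = - 8^-1 * x ^+ 2); last by field.
    have := pow4_expR x; set A := expR (- 2^-1 * _); set B := expR (- 8^-1 * _) => hAB.
    have -> : normal_peak 1 * (256 / 9) / normal_peak 2 * (normal_peak 2 * B) =
      normal_peak 1 * (256 / 9 * B) by field; exact: lt0r_neq0.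
    by rewrite mulrCA ler_wpM2l.
rewrite ge0_integralZl//.
- by rewrite integral_normal_pdf mule1 ltry.
- by apply/measurable_EFinP; exact: measurable_normal_pdf.
- by move=> x _; rewrite lee_fin normal_pdf_ge0.
Qed.

(** The integral over [[-a, a]] is [F a - F (-a)], which tends to [0] since [F]
    decays at least like [1 / |x|]. *)
Lemma integral_derivative_eq0 (F f : R -> R) (C : R) :
  (forall x : R, is_derive x 1 F (f x)) -> continuous f ->
  lam.-integrable setT (EFin \o f) -> (forall x, `|F x| * `|x| <= C) ->
  (\int[lam]_x (f x)%:E = 0)%E.
Proof.
move=> dF cf intf FC.
pose a n : R := n.+1%:R.
have a0 n : 0 < a n by rewrite ltr0n.
have cF : continuous F.
  by move=> x; apply: differentiable_continuous; apply/derivable1_diffP; case: (dF x).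
have E n : (\int[lam]_(x in `[(- a n)%R, (a n)%R]) (f x)%:E = (F (a n) - F (- a n))%:E)%E.
  rewrite (@continuous_FTC2 _ f F)//.
  - by rewrite (lt_trans _ (a0 n))// oppr_lt0.
  - exact: continuous_subspaceT.
  - split; first by move=> x _; case: (dF x).
    + by apply: cvg_at_right_filter; exact: cF.
    + by apply: cvg_at_left_filter; exact: cF.
  - by move=> x _; rewrite derive1E; have /@derive_val -> := dF x.
have cv0 : (F (a n) - F (- a n))%:E @[n --> \oo] --> 0%E.
  apply: cvg_EFin; first exact: nearW.
  apply: norm_cvg0.
  apply: (@squeeze_cvgr _ _ _ _ (cst 0) (fun n => (C + C) * (a n)^-1)).
  - apply: nearW => n; rewrite normr_ge0/= (le_trans (ler_normB _ _))//.
    rewrite -(ler_pM2r (a0 n)) divfK ?gt_eqF// mulrDl lerD//.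
      by rewrite -{2}(gtr0_norm (a0 n)).
    by rewrite -{2}(gtr0_norm (a0 n)) -(normrN (a n)).
  - exact: cvg_cst.
  - rewrite -(mulr0 (C + C)); apply: cvgM; first exact: cvg_cst.
    exact: cvg_harmonic.
have cvI : (\int[lam]_x ((EFin \o f) \_ `[(- a n)%R, (a n)%R]) x)%E @[n --> \oo] -->
    (\int[lam]_x (f x)%:E)%E.
  have mf : measurable_fun (setT : set TR) (fun x : TR => (f x)%:E).
    by apply/measurable_EFinP; exact: continuous_measurable_fun.
  have mfn n : measurable_fun (setT : set TR) ((EFin \o f) \_ `[(- a n)%R, (a n)%R]).
    by apply/(measurable_restrictT _ _).1 => //; exact: measurable_funTS.
  have ae1 : {ae lam, forall x : TR, setT x ->
      ((EFin \o f) \_ `[(- a n)%R, (a n)%R]) x @[n --> \oo] --> (f x)%:E}.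
    apply: aeW => x _; apply: cvg_near_cst.
    near=> n; rewrite patchE mem_set//= in_itv/= -ler_norml.
    rewrite (le_trans (ltW (truncnS_gt _)))// ler_nat.
    near: n; exact: nbhs_infty_ge.
  have ae2 : {ae lam, forall (x : TR) n, setT x ->
      (`|((EFin \o f) \_ `[(- a n)%R, (a n)%R]) x| <= (abse \o (EFin \o f)) x)%E}.
    apply: aeW => x n _; rewrite patchE; case: ifP => // _.
    by rewrite abse0; exact: abse_ge0.
  have [_ _ h] := @dominated_convergence _ TR R lam setT measurableT _ _ _
    mfn mf ae1 (integrable_abse intf) ae2.
  exact: h.
have cvI0 : (\int[lam]_x ((EFin \o f) \_ `[(- a n)%R, (a n)%R]) x)%E @[n --> \oo] --> 0%E.
  by under eq_cvg do rewrite -integral_mkcond E.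
exact: (cvg_unique _ cvI cvI0).
Unshelve. all: by end_near. Qed.

Let idTR : TR -> R := idfun.
#[local] HB.instance Definition _ :=
  @isMeasurableFun.Build _ _ _ _ idTR (@measurable_id _ _ setT).

(** The normal law transported along the identity to the Borel structure that
    random variables with values in [R] use. *)
Definition std_normal : probability R R := distribution gam (idTR : {mfun TR >-> R}).

Lemma integrable_std_normal (f : R -> R) : measurable_fun setT f ->
  std_normal.-integrable setT (EFin \o f) <->
  gam.-integrable setT (EFin \o f : TR -> \bar R).
Proof. by move=> mf; exact: (@integrable_distribution _ _ _ _ _ gam (idTR : {mfun TR >-> R})). Qed.

Lemma integral_std_normal (f : R -> R) :
  std_normal.-integrable setT (EFin \o f) ->
  (\int[std_normal]_x (f x)%:E = \int[gam]_x (f x)%:E)%E.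
Proof.
move=> intf; apply: (@integral_distribution_EFin _ _ _ _ _ gam (idTR : {mfun TR >-> R})) => //.
by apply/measurable_EFinP; case/integrableP : intf.
Qed.

Lemma integrable_pow4_std_normal :
  std_normal.-integrable setT (EFin \o (fun x : R => `|x| ^+ 4)).
Proof.
have mp : measurable_fun setT (fun x : R => `|x| ^+ 4).
  by apply: measurable_funX; exact: normr_measurable.
apply/integrable_std_normal => //; apply/integrableP; split.
  exact/measurable_EFinP.
apply: le_lt_trans integral_pow4_normal_lty; rewrite le_eqVlt; apply/orP; left; apply/eqP.
by apply: eq_integral => x _; rewrite /= ger0_norm// exprn_ge0.
Qed.

Lemma integrable_density (f : R -> R) :
  std_normal.-integrable setT (EFin \o f) ->
  lam.-integrable setT (EFin \o (fun x : TR => f x * normal_pdf 0 1 x)).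
Proof.
move=> intf; have mf0 : measurable_fun setT f.
  by apply/measurable_EFinP; case/integrableP : intf.
move: intf => /(integrable_std_normal mf0)/integrableP[mf intf].
apply/integrableP; split.
  apply/measurable_EFinP; apply: measurable_funM; first exact/measurable_EFinP.
  exact: measurable_normal_pdf.
rewrite ge0_integral_normal// in intf; last exact: measurableT_comp.
apply: le_lt_trans intf; rewrite le_eqVlt; apply/orP; left; apply/eqP.
apply: eq_integral => x _ /=.
by rewrite normrM EFinM (ger0_norm (normal_pdf_ge0 _ _ _)).
Qed.

Lemma std_normal_derivative_eq0 (F f : R -> R) (C : R) :
  (forall x : R, is_derive x 1 F (f x * normal_pdf 0 1 x)) -> continuous f ->
  std_normal.-integrable setT (EFin \o f) -> (forall x, `|F x| * `|x| <= C) ->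
  \int[std_normal]_x f x = 0.
Proof.
move=> dF cf intf FC.
have mf : measurable_fun setT f by apply/measurable_EFinP; case/integrableP : intf.
rewrite /Rintegral integral_std_normal// integral_normal; last exact/(integrable_std_normal mf).
under eq_integral do rewrite -EFinM.
rewrite (integral_derivative_eq0 dF _ _ FC)//; last exact: integrable_density.
move=> x; apply: cvgM; first exact: cf.
by apply: continuous_normal_pdf; exact: oner_neq0.
Qed.

Lemma sqr_normal_pdf_le (x : R) : x ^+ 2 * normal_pdf 0 1 x <= normal_peak 1 * 2.
Proof.
rewrite normal_pdf01E mulrCA ler_wpM2l ?normal_peak_ge0//.
have h := expR_ge1Dx (2^-1 * x ^+ 2).
rewrite mulNr expRN ler_pdivrMr ?expR_gt0//.
by have := sqr_ge0 x; lra.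
Qed.

(** [x * pdf x] is the derivative of [- pdf x]. *)
Lemma std_normal_mean : \int[std_normal]_x (x ^+ 1) = 0.
Proof.
have peak0 := normal_peak_ge0 (1 : R).
apply: (@std_normal_derivative_eq0 (fun x => - normal_pdf 0 1 x) _ (normal_peak 1 * 2)).
- move=> x; have := is_deriveN (is_derive_normal_pdf x).
  by rewrite mulNr opprK expr1.
- by move=> x; exact: exprn_continuous.
- exact: (integrable_pow (isT : 1 <= 4)%N integrable_pow4_std_normal).
- move=> x; rewrite normrN (ger0_norm (normal_pdf_ge0 _ _ _)).
  have h2 := sqr_normal_pdf_le x.
  have h0 := @normal_pdf_ub _ 0 1 x (oner_neq0 R).
  have p0 := @normal_pdf_ge0 _ 0 1 x.
  rewrite -[x ^+ 2]real_normK ?num_real// in h2.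
  move: h2 h0 p0; set a := `|x|; set p := normal_pdf _ _ _; set c := normal_peak _ in peak0 *.
  have a0 : 0 <= a by exact: normr_ge0.
  by nra.
Qed.

(** [(1 - x^2) * pdf x] is the derivative of [x * pdf x]. *)
Lemma std_normal_variance : \int[std_normal]_x (x ^+ 2) = 1.
Proof.
have peak0 := normal_peak_ge0 (1 : R).
have i0 := @integrable_pow _ 4 _ 0%N isT integrable_pow4_std_normal.
have i2 := @integrable_pow _ 4 _ 2 isT integrable_pow4_std_normal.
have : \int[std_normal]_x (x ^+ 0 - x ^+ 2) = 0.
  apply: (@std_normal_derivative_eq0 (fun x => x * normal_pdf 0 1 x) _ (normal_peak 1 * 2)).
  - by move=> x; rewrite expr0; exact: is_derive_id_normal_pdf.
  - by move=> x; apply: cvgB; exact: exprn_continuous.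
  - rewrite (_ : EFin \o _ = (EFin \o (fun x => x ^+ 0)%R) \- (EFin \o (fun x => x ^+ 2)%R))%E//.
    exact: integrableB.
  - move=> x; rewrite normrM (ger0_norm (normal_pdf_ge0 _ _ _)) mulrAC.
    by rewrite -expr2 real_normK ?num_real// sqr_normal_pdf_le.
rewrite RintegralB// => /eqP; rewrite subr_eq0 => /eqP <-.
under eq_Rintegral do rewrite expr0.
exact: (Rintegral_cst_probability std_normal 1).
Qed.

End normal_moments.

(** * The Hamiltonian of the mixed p-spin model *)

Section model.
Variables (R : realType).

Definition level (N p : nat) : seq (disorder_index N) :=
  [seq Tagged (fun p => {ffun 'I_p -> 'I_N}) i | i <- enum {ffun 'I_p -> 'I_N}].

Definition truncated_indices (N n : nat) : seq (disorder_index N) :=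
  flatten [seq level N p | p <- index_iota 2 n].

Definition coupling (beta : nat -> R) (N p : nat) : R :=
  beta p / N%:R `^ ((p%:R - 1) / 2).

Definition direction (N : nat) (k : disorder_index N) (s : config N) : R :=
  \prod_(j < tag k) spin R s (tagged k j).

Lemma mem_level N p k : k \in level N p -> tag k = p.
Proof. by case/mapP => i _ ->. Qed.

Lemma size_level N p : size (level N p) = (N ^ p)%N.
Proof. by rewrite size_map -cardE card_ffun !card_ord. Qed.

Lemma uniq_level N p : uniq (level N p).
Proof.
rewrite map_inj_uniq ?enum_uniq// => i j /eqP.
by rewrite eq_Tagged => /eqP.
Qed.

Lemma mem_flatten_level N ps k :
  k \in flatten [seq level N p | p <- ps] -> tag k \in ps.
Proof. by case/flatten_mapP => p pps /mem_level ->. Qed.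

Lemma uniq_flatten_level N ps : uniq ps -> uniq (flatten [seq level N p | p <- ps]).
Proof.
elim: ps => //= p ps IH /andP[pps ups].
rewrite cat_uniq uniq_level IH// andbT /=.
apply/hasPn => k /mem_flatten_level kps; apply/negP => /mem_level kp.
by move: pps; rewrite -kp kps.
Qed.

Lemma uniq_truncated_indices N n : uniq (truncated_indices N n).
Proof. by apply: uniq_flatten_level; exact: iota_uniq. Qed.

Lemma truncated_indices_sub N n : [set` truncated_indices N n] `<=` @model_index N.
Proof. by move=> k /mem_flatten_level; rewrite mem_index_iota => /andP[]. Qed.

Lemma level_sub N p : (2 <= p)%N -> [set` level N p] `<=` @model_index N.
Proof. by move=> p2 k /mem_level kp; rewrite /model_index/= kp. Qed.

Lemma sum_truncated_indices N n (F : disorder_index N -> R) :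
  \sum_(k <- truncated_indices N n) F k =
  \sum_(2 <= p < n) \sum_(k <- level N p) F k.
Proof. by rewrite big_flatten/= big_map. Qed.

Lemma sum_level_tag N p (F : nat -> R) :
  \sum_(k <- level N p) F (tag k) = N%:R ^+ p * F p.
Proof.
rewrite (eq_big_seq (fun=> F p)); last by move=> k /mem_level ->.
by rewrite big_const_seq count_predT size_level iter_addr addr0 -natrX mulr_natl.
Qed.

Definition level_energy (beta : nat -> R) N p (x : disorder_index N -> R)
    (s : config N) : R :=
  \sum_(k <- level N p) coupling beta N (tag k) * direction k s * x k.

Lemma level_energyE beta N p x s :
  beta p / N%:R `^ ((p%:R - 1) / 2) * \sum_(i : {ffun 'I_p -> 'I_N})
      x (Tagged (fun p => {ffun 'I_p -> 'I_N}) i) *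
      \prod_(k < p) spin R s (i k) = @level_energy beta N p x s.
Proof.
rewrite -/(coupling beta N p) /level_energy big_map big_enum/= mulr_sumr; apply: eq_bigr => i _.
by rewrite /direction/=; ring.
Qed.

Lemma hamiltonianE beta h N x (s : config N) :
  hamiltonian beta h x s =
  limn (fun n => \sum_(2 <= p < n) level_energy beta p x s) +
  h * \sum_(i < N) spin R s i.
Proof.
rewrite /hamiltonian; congr (_ + _).
apply: (congr1 (fun u : nat -> R => limn u)); apply/funext => n.
by apply: eq_bigr => p _; exact: level_energyE.
Qed.

Lemma norm_direction N (k : disorder_index N) s : `|direction k s| = 1.
Proof. by rewrite normr_prod big1// => j _; rewrite /spin normr_sign. Qed.

Lemma couplingE beta N p : coupling beta N p.+1 = beta p.+1 / Num.sqrt N%:R ^+ p.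
Proof.
rewrite /coupling -powR12_sqrt// -powR_mulrn ?powR_ge0// -powRrM.
by congr (_ / _ `^ _); rewrite -natr1 addrK mulrC.
Qed.

(** There are [N ^ p] variables of order [p]. *)
Lemma coupling_sqr beta N p : (0 < N)%N -> (0 < p)%N ->
  N%:R ^+ p * coupling beta N p ^+ 2 = beta p ^+ 2 * N%:R.
Proof.
case: p => // p N0 _; rewrite couplingE.
set r := Num.sqrt _.
have r0 : r != 0 by rewrite gt_eqF// sqrtr_gt0 ltr0n.
have -> : N%:R = r ^+ 2 by rewrite sqr_sqrtr.
rewrite -exprM mulnC exprM (exprS r p).
have := expf_neq0 p r0; move: (r ^+ p) => A A0.
by field.
Qed.

(** From [delta |y| <= delta^2 + y^2].  It converts second moments into first
    moments with a free weight [delta], used with [delta = 2^-p]. *)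
Lemma norm_le_sqr (y delta : R) : 0 < delta -> `|y| <= delta + delta^-1 * y ^+ 2.
Proof.
move=> d0; rewrite -[y ^+ 2]real_normK ?num_real//; set a := `|y|.
rewrite -(ler_pM2l d0) mulrDr mulrA divff ?gt_eqF// mul1r.
have a0 : 0 <= a by exact: normr_ge0.
nra.
Qed.

Section convergence.
Variables (beta : nat -> R).
Hypothesis beta_sum : (\sum_(2 <= p <oo) (2 ^+ p * beta p ^+ 2)%:E < +oo)%E.
Context d (T : measurableType d) (P : probability T R).
Variables (N : nat) (X : disorder_index N -> {RV P >-> R}) (mu : probability R R).
Hypothesis N0 : (0 < N)%N.
Hypothesis indX : independent_on (@model_index N) X.
Hypothesis lawX : forall i, model_index i -> forall A, measurable A ->
  distribution P (X i) A = mu A.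
Hypothesis imu : mu.-integrable setT (EFin \o (fun x : R => `|x| ^+ 2)).
Hypothesis mu1 : \int[mu]_x (x ^+ 1) = 0.
Hypothesis mu2 : \int[mu]_x (x ^+ 2) = 1.

Lemma beta_partial_sums : exists B : R, forall n,
  \sum_(2 <= p < n) 2 ^+ p * beta p ^+ 2 <= B.
Proof.
have s0 : (0 <= \sum_(2 <= p <oo) (2 ^+ p * beta p ^+ 2)%:E)%E.
  by apply: nneseries_ge0 => p _ _; rewrite lee_fin mulr_ge0 ?sqr_ge0.
exists (fine (\sum_(2 <= p <oo) (2 ^+ p * beta p ^+ 2)%:E)) => n.
rewrite -lee_fin fineK ?ge0_fin_numE// -sumEFin.
by apply: nneseries_lim_ge => p _ _; rewrite lee_fin mulr_ge0 ?sqr_ge0.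
Qed.

Let Y p s w := level_energy beta p (fun k => X k w) s.

Lemma measurable_level_energy p s : measurable_fun setT (Y p s).
Proof. by apply: measurable_sum_seq => k _; apply: measurable_funM. Qed.

Lemma level_energy_sqr p s : (2 <= p)%N ->
  (\int[P]_w (Y p s w ^+ 2)%:E = (beta p ^+ 2 * N%:R)%:E)%E.
Proof.
move=> p2.
have := second_moment_sum indX lawX imu mu1 mu2
  (fun k => coupling beta N (tag k) * direction k s) 0 (uniq_level N p) (level_sub p2).
under eq_integral do rewrite add0r.
rewrite /Y /level_energy => ->; rewrite expr0n add0r -(coupling_sqr beta N0); last exact: ltnW.
congr EFin; rewrite -(sum_level_tag N p (fun p => coupling beta N p ^+ 2)).
apply: eq_bigr => k _; rewrite exprMn -[direction k s ^+ 2]real_normK ?num_real//.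
by rewrite norm_direction expr1n mulr1.
Qed.

Lemma level_energy_abs p s : (2 <= p)%N ->
  (\int[P]_w `|Y p s w|%:E <= ((2 ^+ p)^-1 + 2 ^+ p * (beta p ^+ 2 * N%:R))%:E)%E.
Proof.
move=> p2; have d0 : 0 < (2 ^+ p)^-1 :> R by rewrite invr_gt0 exprn_gt0.
have mY2 : measurable_fun setT (fun w => (Y p s w ^+ 2)%:E).
  by apply/measurable_EFinP/measurable_funX; exact: measurable_level_energy.
have Y20 w : (0 <= (Y p s w ^+ 2)%:E)%E by rewrite lee_fin sqr_ge0.
have e0 : (0 <= (2 ^+ p : R)%:E)%E by rewrite lee_fin exprn_ge0.
apply: (@le_trans _ _ (\int[P]_w (((2 ^+ p)^-1)%:E + (2 ^+ p)%:E * (Y p s w ^+ 2)%:E))%E).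
  apply: ge0_le_integral => //.
  - by apply/measurable_EFinP; apply: measurableT_comp => //; exact: measurable_level_energy.
  - by apply: emeasurable_funD => //; exact: measurable_funeM.
  - by move=> w _; rewrite -EFinM -EFinD lee_fin; have := norm_le_sqr (Y p s w) d0; rewrite invrK.
rewrite ge0_integralD//; last 2 first.
- by move=> w _; exact: mule_ge0.
- exact: measurable_funeM.
rewrite ge0_integralZl// level_energy_sqr// integral_cst// EFinD EFinM leeD2r//.
rewrite -[leRHS]mule1; apply: lee_wpmul2l; first by rewrite lee_fin ltW.
exact: probability_le1.
Qed.

Lemma sum_inv_pow2 n : \sum_(0 <= p < n) (2 ^+ p)^-1 <= 2 :> R.
Proof.
have -> : \sum_(0 <= p < n) (2 ^+ p)^-1 = 2 - 2 * (2 ^+ n)^-1 :> R.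
  elim: n => [|n IH]; first by rewrite big_geq// expr0 invr1; ring.
  rewrite big_nat_recr//= IH exprS invfM; field.
  by rewrite expf_neq0.
by rewrite gerBl mulr_ge0// invr_ge0 exprn_ge0.
Qed.

Lemma sum_from2 (F : nat -> R) n :
  \sum_(0 <= p < n) (if (2 <= p)%N then F p else 0) = \sum_(2 <= p < n) F p.
Proof. by rewrite -big_mkcond/= (big_nat_widenl 2 0). Qed.

Let u s w p := if (2 <= p)%N then Y p s w else 0.

Lemma partial_sums_u s w n : \sum_(2 <= p < n) Y p s w = series (u s w) n.
Proof. by rewrite /series/= /u sum_from2. Qed.

(** The expectation of the sum is at most [2 + N * \sum 2^p beta_p^2]. *)
Lemma ae_summable_level_energy s :
  {ae P, forall w, (\sum_(0 <= p <oo) `|u s w p|%:E)%E \is a fin_num}.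
Proof.
have [B hB] := beta_partial_sums.
have mu_ p : measurable_fun setT (fun w => `|u s w p|%:E).
  apply/measurable_EFinP; apply: measurableT_comp => //.
  rewrite /u; case: (2 <= p)%N; last exact: measurable_cst.
  exact: measurable_level_energy.
have u0 p w : (0 <= `|u s w p|%:E)%E by rewrite lee_fin.
have S0 w : (0 <= \sum_(0 <= p <oo) `|u s w p|%:E)%E by exact: nneseries_ge0.
have mS : measurable_fun setT (fun w => \sum_(0 <= p <oo) `|u s w p|%:E)%E.
  exact: ge0_emeasurable_sum.
suff iS : P.-integrable setT (fun w => \sum_(0 <= p <oo) `|u s w p|%:E)%E.
  by have := integrable_ae measurableT iS; apply: filterS => w; apply.
apply/integrableP; split => //.
under eq_integral do rewrite gee0_abs//.
rewrite integral_nneseries//.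
apply: (@le_lt_trans _ _ (2 + N%:R * B)%:E); last exact: ltry.
apply: lime_le; first by apply: is_cvg_nneseries => p _ _; exact: integral_ge0.
apply: nearW => n.
apply: (@le_trans _ _ (\sum_(0 <= p < n)
  ((2 ^+ p)^-1 + (if (2 <= p)%N then N%:R * (2 ^+ p * beta p ^+ 2) else 0))%:E)%E).
  apply: lee_sum => p _; rewrite /u; case: ifP => p2.
    apply: (le_trans (level_energy_abs s p2)); rewrite lee_fin lerD2l.
    by rewrite mulrA mulrC.
  rewrite normr0 integral0 lee_fin addr0 invr_ge0; exact: exprn_ge0.
rewrite sumEFin lee_fin big_split/= lerD ?sum_inv_pow2//.
by rewrite sum_from2 -mulr_sumr ler_wpM2l.
Qed.

Lemma ae_cvg_partial_hamiltonian s :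
  {ae P, forall w, cvgn (fun n => \sum_(2 <= p < n) Y p s w)}.
Proof.
have := ae_summable_level_energy s; apply: filterS => w finS.
under eq_fun do rewrite partial_sums_u.
apply: normed_cvg; apply: nondecreasing_is_cvgn.
  move=> m n mn; rewrite /series/= [leRHS](@big_cat_nat _ _ _ m)//= lerDl.
  exact: sumr_ge0.
exists (fine (\sum_(0 <= p <oo) `|u s w p|%:E)%E) => _ [n _ <-].
rewrite -lee_fin fineK// /series/= -sumEFin.
by apply: nneseries_lim_ge => p _ _; rewrite lee_fin.
Qed.

(** Almost surely for all configurations at once, as there are finitely many. *)
Lemma ae_cvg_hamiltonian h : {ae P, forall w, forall s,
  \sum_(2 <= p < n) Y p s w + h * \sum_(i < N) spin R s i @[n --> \oo] -->
  hamiltonian beta h (fun k => X k w) s}.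
Proof.
apply: filterS (filter_forall _ ae_cvg_partial_hamiltonian) => w cw s.
rewrite hamiltonianE; apply: cvgD; last exact: cvg_cst.
exact: cw.
Qed.

Lemma partial_hamiltonianE h n s w :
  \sum_(2 <= p < n) Y p s w + h * \sum_(i < N) spin R s i =
  perturb (fun k s => coupling beta N (tag k) * direction k s)
    (fun s => h * \sum_(i < N) spin R s i) (truncated_indices N n) (fun k => X k w) s.
Proof.
rewrite /perturb sum_truncated_indices addrC; congr (_ + _).
by apply: eq_bigr => p _; apply: eq_bigr => k _; rewrite mulrC.
Qed.

End convergence.

Lemma cvg_bigsum (J : Type) (r : seq J) (F : J -> nat -> R) (l : J -> R) :
  (forall j, F j n @[n --> \oo] --> l j) ->
  \sum_(j <- r) F j n @[n --> \oo] --> \sum_(j <- r) l j.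
Proof.
move=> Fl; elim: r => [|j r IH].
  by under eq_cvg do rewrite big_nil; rewrite big_nil; exact: cvg_cst.
by under eq_cvg do rewrite big_cons; rewrite big_cons; exact: cvgD.
Qed.

Lemma cvg_gibbs_avg3 N (Xn : nat -> config N -> R) (X : config N -> R) f :
  (forall s, Xn n s @[n --> \oo] --> X s) ->
  gibbs_avg3 (Xn n) f @[n --> \oo] --> gibbs_avg3 X f.
Proof.
move=> cX.
have cE s : expR (Xn n s) @[n --> \oo] --> expR (X s).
  by apply: (cvg_comp _ _ (cX s)); exact: continuous_expR.
have cG s : gibbs (Xn n) s @[n --> \oo] --> gibbs X s.
  apply: cvgM => //; apply: cvgV.
    rewrite gt_eqF// (bigD1 [ffun=> false])//=; apply: ltr_pwDl; first exact: expR_gt0.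
    by apply: sumr_ge0 => s' _; exact: expR_ge0.
  by apply: cvg_bigsum.
rewrite /gibbs_avg3.
do 3 apply: cvg_bigsum => ?.
apply: cvgM; last exact: cvg_cst.
by apply: cvgM => //; exact: cvgM.
Qed.

End model.

(** * Comparison of two disorders at a fixed size *)

Section one_size.
Variables (R : realType) (beta : nat -> R) (h : R) (N : nat).
Hypothesis N0 : (0 < N)%N.
Hypothesis beta_sum : (\sum_(2 <= p <oo) (2 ^+ p * beta p ^+ 2)%:E < +oo)%E.
Variable f : config N -> config N -> config N -> R.
Hypothesis f01 : forall s1 s2 s3, 0 <= f s1 s2 s3 <= 1.

Let dir (k : disorder_index N) (s : config N) : R :=
  coupling beta N (tag k) * direction R k s.
Let external (s : config N) : R := h * \sum_(i < N) spin R s i.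

Section one_disorder.
Context d (T : measurableType d) (P : probability T R).
Variables (X : disorder_index N -> {RV P >-> R}) (mu : probability R R).
Hypothesis indX : independent_on (@model_index N) X.
Hypothesis lawX : forall i, model_index i -> forall A, measurable A ->
  distribution P (X i) A = mu A.
Hypothesis imu : mu.-integrable setT (EFin \o (fun x : R => `|x| ^+ 2)).
Hypothesis mu1 : \int[mu]_x (x ^+ 1) = 0.
Hypothesis mu2 : \int[mu]_x (x ^+ 2) = 1.

Definition gibbs_mean : \bar R :=
  (\int[P]_w (gibbs_avg3 (hamiltonian beta h (fun k => X k w)) f)%:E)%E.

(** Dominated convergence in the truncation: the Gibbs average is a continuous
    function of the energies, with values in [[0, 1]]. *)
Lemma cvg_truncated_mean :
  mean_perturb (fun v => gibbs_avg3 v f) dir X (truncated_indices N n) external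
    @[n --> \oo] --> fine gibbs_mean /\ gibbs_mean \is a fin_num.
Proof.
pose u n w := gibbs_avg3 (perturb dir external (truncated_indices N n) (fun k => X k w)) f.
apply: (@bounded_ae_cvg_integral _ _ _ P u).
- move=> n; apply: (@measurable_Phi_perturb _ _ (fun v => gibbs_avg3 v f)).
  by move=> *; exact: measurable_gibbs_avg3.
- by move=> n w; exact: gibbs_avg3_bounds.
- by move=> w; case/andP: (gibbs_avg3_bounds (hamiltonian beta h (fun k => X k w)) f01).
- apply: filterS (ae_cvg_hamiltonian beta_sum N0 indX lawX imu mu1 mu2 h) => w cw.
  apply: cvg_gibbs_avg3 => s; have := cw s.
  by under eq_cvg do rewrite partial_hamiltonianE.
Qed.

End one_disorder.

Section comparison.
Context d (T : measurableType d) (P : probability T R) (X : disorder_index N -> {RV P >-> R}).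
Context d' (T' : measurableType d') (P' : probability T' R)
  (X' : disorder_index N -> {RV P' >-> R}).
Variables (mu nu : probability R R) (m : nat) (C r B : R).
Hypothesis indX : independent_on (@model_index N) X.
Hypothesis indX' : independent_on (@model_index N) X'.
Hypothesis lawX : forall i, model_index i -> forall A, measurable A ->
  distribution P (X i) A = mu A.
Hypothesis lawX' : forall i, model_index i -> forall A, measurable A ->
  distribution P' (X' i) A = nu A.
Hypothesis imu : mu.-integrable setT (EFin \o (fun x : R => `|x| ^+ 2)).
Hypothesis mu1 : \int[mu]_x (x ^+ 1) = 0.
Hypothesis mu2 : \int[mu]_x (x ^+ 2) = 1.
Hypothesis inu : nu.-integrable setT (EFin \o (fun x : R => `|x| ^+ 2)).
Hypothesis nu1 : \int[nu]_x (x ^+ 1) = 0.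
Hypothesis nu2 : \int[nu]_x (x ^+ 2) = 1.
Hypothesis C0 : 0 <= C.
Hypothesis r0 : 0 <= r.
Hypothesis swap : forall (v e : config N -> R) a, 0 <= a -> (forall s, `|e s| <= 1) ->
  `|\int[mu]_t gibbs_avg3 (fun s => v s + t * (a * e s)) f -
    \int[nu]_t gibbs_avg3 (fun s => v s + t * (a * e s)) f| <=
  C * (a ^+ m * (capped_moment m mu a + capped_moment m nu a)).
Hypothesis beta_ge0 : forall p, (2 <= p)%N -> 0 <= beta p.
Hypothesis sumB : forall n, \sum_(2 <= p < n) 2 ^+ p * beta p ^+ 2 <= B.
Hypothesis level_le : forall p, (2 <= p)%N ->
  N%:R ^+ p * (coupling beta N p ^+ m *
    (capped_moment m mu (coupling beta N p) + capped_moment m nu (coupling beta N p))) <=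
  2 ^+ p * beta p ^+ 2 * r.

(** [B] bounds the partial sums of [2^p beta_p^2] and [level_le] bounds the cost of
    each order, so the total does not depend on the truncation [n]. *)
Lemma truncated_comparison n v :
  `|mean_perturb (fun v => gibbs_avg3 v f) dir X (truncated_indices N n) v -
    mean_perturb (fun v => gibbs_avg3 v f) dir X' (truncated_indices N n) v| <= C * (B * r).
Proof.
pose F p := C * (coupling beta N p ^+ m *
    (capped_moment m mu (coupling beta N p) + capped_moment m nu (coupling beta N p))).
apply: (@le_trans _ _ (\sum_(k <- truncated_indices N n) F (tag k))).
  apply: (@lindeberg_replacement _ _ (fun v => gibbs_avg3 v f) _ _ _ _ dir _ _ _ _
    _ _ _ _ _ _ (fun k => F (tag k)) indX indX' lawX lawX').
  - by move=> u; exact: gibbs_avg3_bounds.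
  - by move=> *; exact: measurable_gibbs_avg3.
  - move=> k k2 u; apply: swap.
      by rewrite divr_ge0 ?powR_ge0// beta_ge0.
    by move=> s; rewrite norm_direction.
  - exact: uniq_truncated_indices.
  - exact: truncated_indices_sub.
rewrite sum_truncated_indices.
under eq_bigr do rewrite sum_level_tag /F mulrCA.
rewrite -mulr_sumr ler_wpM2l// (le_trans _ (ler_wpM2r r0 (sumB n)))// mulr_suml.
rewrite big_nat_cond [leRHS]big_nat_cond.
by apply: ler_sum => p /andP[/andP[p2 _] _]; exact: level_le.
Qed.

Lemma gibbs_mean_comparison :
  gibbs_mean X \is a fin_num /\ gibbs_mean X' \is a fin_num /\
  `|fine (gibbs_mean X) - fine (gibbs_mean X')| <= C * (B * r).
Proof.
have [cX fX] := cvg_truncated_mean indX lawX imu mu1 mu2.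
have [cX' fX'] := cvg_truncated_mean indX' lawX' inu nu1 nu2.
split=> //; split=> //.
pose u n := `|mean_perturb (fun v => gibbs_avg3 v f) dir X (truncated_indices N n) external
  - mean_perturb (fun v => gibbs_avg3 v f) dir X' (truncated_indices N n) external|.
have cu : u n @[n --> \oo] --> `|fine (gibbs_mean X) - fine (gibbs_mean X')|.
  by apply: cvg_norm; exact: cvgB.
by apply: (cvg_le_bound cu) => n; exact: truncated_comparison.
Qed.

End comparison.
End one_size.

(** * Rates as the size tends to infinity *)

Section rates.
Variable R : realType.

Lemma cvg_inv_sqrt_nat : (Num.sqrt N%:R)^-1 @[N --> \oo] --> (0 : R).
Proof.
have hN : (N%:R)^-1 @[N --> \oo] --> (0 : R).
  by rewrite -cvg_shiftS; exact: cvg_harmonic.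
have : Num.sqrt (N%:R)^-1 @[N --> \oo] --> (Num.sqrt 0 : R).
  by apply: (cvg_comp _ _ hN); exact: sqrt_continuous.
by rewrite sqrtr0; under eq_cvg do rewrite sqrtrV//.
Qed.

Lemma capped_moment_ge0 m (mu : probability R R) a : 0 <= a -> 0 <= capped_moment m mu a.
Proof.
move=> a0; apply: Rintegral_ge0 => x _.
by rewrite mulr_ge0 ?exprn_ge0// le_min ler01 mulr_ge0.
Qed.

Lemma le_capped_moment m (mu : probability R R) a b : 0 <= a -> a <= b ->
  mu.-integrable setT (EFin \o (fun x : R => `|x| ^+ m)) ->
  capped_moment m mu a <= capped_moment m mu b.
Proof.
move=> a0 ab im; apply: le_Rintegral => //.
- exact: integrable_capped.
- by apply: integrable_capped => //; exact: le_trans ab.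
- move=> x _; rewrite ler_wpM2l ?exprn_ge0// le_min ge_min lexx/=.
  by rewrite ge_min ler_wpM2r ?orbT.
Qed.

Lemma capped_moment_le m (mu : probability R R) a : 0 <= a ->
  mu.-integrable setT (EFin \o (fun x : R => `|x| ^+ m)) ->
  mu.-integrable setT (EFin \o (fun x : R => `|x| ^+ m.+1)) ->
  capped_moment m mu a <= a * \int[mu]_x (`|x| ^+ m.+1).
Proof.
move=> a0 im im1; rewrite -RintegralZl//; apply: le_Rintegral => //.
- exact: integrable_capped.
- rewrite (_ : EFin \o _ = (fun x => a%:E * (EFin \o (fun x : R => `|x| ^+ m.+1)%R) x))%E//.
  exact: integrableZl.
- move=> x _; rewrite exprSr mulrCA ler_wpM2l ?exprn_ge0//.
  by rewrite ge_min lexx orbT.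
Qed.

Lemma capped_moment_cvg0 m (mu : probability R R) (a : nat -> R) :
  (forall n, 0 <= a n) -> a n @[n --> \oo] --> (0 : R) ->
  mu.-integrable setT (EFin \o (fun x : R => `|x| ^+ m)) ->
  capped_moment m mu (a n) @[n --> \oo] --> (0 : R).
Proof.
move=> a0 acvg im.
pose u n (x : R) := `|x| ^+ m * Num.min 1 (a n * `|x|).
have u0 n x : 0 <= u n x.
  by rewrite mulr_ge0 ?exprn_ge0// le_min ler01 mulr_ge0.
have mEu n : measurable_fun setT (fun x => (u n x)%:E).
  by apply/measurable_EFinP; exact: measurable_capped.
have ae1 : {ae mu, forall x, setT x -> (u n x)%:E @[n --> \oo] --> (cst 0%E : R -> \bar R) x}.
  apply: aeW => x _; apply: cvg_EFin; first exact: nearW.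
  apply: (@squeeze_cvgr _ _ _ _ (cst 0) (fun n => `|x| ^+ m * (a n * `|x|))).
  - apply: nearW => n; rewrite u0/= ler_wpM2l ?exprn_ge0//.
    by rewrite ge_min lexx orbT.
  - exact: cvg_cst.
  - rewrite -[X in _ --> X](mulr0 (`|x| ^+ m)); apply: cvgM; first exact: cvg_cst.
    by rewrite -[X in _ --> X](mul0r `|x|); apply: cvgM => //; exact: cvg_cst.
have ae2 : {ae mu, forall x n, setT x ->
    (`|(u n x)%:E| <= (EFin \o (fun x : R => `|x| ^+ m)%R) x)%E}.
  apply: aeW => x n _ /=; rewrite lee_fin ger0_norm// ler_piMr ?exprn_ge0//.
  by rewrite ge_min lexx.
have [_ _ cv] := dominated_convergence measurableT mEu (@measurable_cst _ _ _ _ setT 0%E) ae1 im ae2.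
rewrite integral0 in cv.
exact: (@fine_cvg _ _ _ _ (fun n => \int[mu]_x (u n x)%:E)%E).
Qed.

End rates.

Section transfer.
Variables (R : realType) (beta : nat -> R) (h : R).
Hypothesis beta_ge0 : forall p : nat, (2 <= p)%N -> 0 <= beta p.
Hypothesis beta_sum : (\sum_(2 <= p <oo) (2 ^+ p * beta p ^+ 2)%:E < +oo)%E.
Context (d : nat -> measure_display) (T : forall N : nat, measurableType (d N))
  (P : forall N : nat, probability (T N) R)
  (y : forall N : nat, disorder_index N -> {RV (P N) >-> R}).
Context (d' : nat -> measure_display) (T' : forall N : nat, measurableType (d' N))
  (P' : forall N : nat, probability (T' N) R)
  (g : forall N : nat, disorder_index N -> {RV (P' N) >-> R}).
Variables (mu nu : probability R R) (m : nat) (r : nat -> R).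
Hypothesis y_iid : forall N, iid_on (@model_index N) (@y N) mu.
Hypothesis g_iid : forall N, iid_on (@model_index N) (@g N) nu.
Hypothesis m2 : (2 <= m)%N.
Hypothesis imu : mu.-integrable setT (EFin \o (fun x : R => `|x| ^+ m)).
Hypothesis inu : nu.-integrable setT (EFin \o (fun x : R => `|x| ^+ m)).
Hypothesis nu1 : \int[nu]_x (x ^+ 1) = 0.
Hypothesis nu2 : \int[nu]_x (x ^+ 2) = 1.
Hypothesis mom : forall k, (k <= m)%N -> \int[mu]_x (x ^+ k) = \int[nu]_x (x ^+ k).
Hypothesis r0 : forall N, 0 <= r N.
Hypothesis rcvg : r N @[N --> \oo] --> (0 : R).
Hypothesis level_le : forall N p, (0 < N)%N -> (2 <= p)%N ->
  N%:R ^+ p * (coupling beta N p ^+ m *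
    (capped_moment m mu (coupling beta N p) + capped_moment m nu (coupling beta N p))) <=
  2 ^+ p * beta p ^+ 2 * r N.

Lemma integrable_sqr (la : probability R R) :
  la.-integrable setT (EFin \o (fun x : R => `|x| ^+ m)) ->
  la.-integrable setT (EFin \o (fun x : R => `|x| ^+ 2)).
Proof.
move=> im; have := integrable_pow m2 im.
by under eq_fun do rewrite -real_normK ?num_real//.
Qed.

(** The difference of the two means is at most [C * (B * r N)]. *)
Lemma ultrametricity_transfer : ultrametricity beta h (@g) -> ultrametricity beta h (@y).
Proof.
move=> Ug eps eps0; have := Ug eps eps0.
pose f N s1 s2 s3 : R := (@nonultrametric R N eps s1 s2 s3)%:R.
have f01 N s1 s2 s3 : 0 <= f N s1 s2 s3 <= 1 by rewrite /f ler0n lern1 leq_b1.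
pose a N := gibbs_mean beta h (f N) (@y N).
pose b N := gibbs_mean beta h (f N) (@g N).
rewrite [X in X @ _ --> _ -> _](_ : _ = b); last by apply/funext => N; rewrite unlock.
rewrite [X in _ -> X @ _ --> _](_ : _ = a); last by apply/funext => N; rewrite unlock.
move=> b0.
have [C C0 hC] := gibbs_swap R m.
have [B hB] := beta_partial_sums beta_sum.
have comp N : (0 < N)%N -> a N \is a fin_num /\ b N \is a fin_num /\
    `|fine (a N) - fine (b N)| <= C * (B * r N).
  move=> N0; have [indy lawy] := y_iid N; have [indg lawg] := g_iid N.
  apply: (@gibbs_mean_comparison _ _ h _ N0 beta_sum _ (f01 N) _ _ _ _ _ _ _ _
    mu nu m C (r N) B indy indg lawy lawg) => //.
  - exact: integrable_sqr.
  - by rewrite mom// ltnW.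
  - by rewrite mom.
  - exact: integrable_sqr.
  - by move=> v e c c0 e1; apply: hC.
  - by move=> p p2; exact: level_le.
have fb0 : fine (b N) @[N --> \oo] --> (0 : R) by exact: fine_cvg.
have dab0 : (fine (a N) - fine (b N)) @[N --> \oo] --> (0 : R).
  apply: norm_cvg0.
  apply: (@squeeze_cvgr _ _ _ _ (cst 0) (fun N => C * (B * r N))).
  - near=> N; rewrite normr_ge0/=.
    by have [|_ [_ ->]//] := comp N; near: N; exact: nbhs_infty_gt.
  - exact: cvg_cst.
  - rewrite -[X in _ --> X](mulr0 C) -[X in C * X](mulr0 B).
    by do 2 (apply: cvgM; first exact: cvg_cst).
apply: cvg_EFin.
  by near=> N; have [|->//] := comp N; near: N; exact: nbhs_infty_gt.
rewrite -[X in _ --> X](addr0 (0 : R)).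
rewrite (_ : fine \o a = (fun N => (fine (a N) - fine (b N)) + fine (b N))).
  exact: cvgD.
by apply/funext => N /=; rewrite subrK.
Unshelve. all: by end_near. Qed.

End transfer.

Section level_bounds.
Variables (R : realType) (beta : nat -> R).
Hypothesis beta_ge0 : forall p : nat, (2 <= p)%N -> 0 <= beta p.

(** [beta_p^2] is at most the sum of the series, and [x <= 1 + x^2]. *)
Lemma beta_bounded :
  (\sum_(2 <= p <oo) (2 ^+ p * beta p ^+ 2)%:E < +oo)%E ->
  exists2 B : R, 0 <= B & forall p, (2 <= p)%N -> beta p <= B.
Proof.
move=> /beta_partial_sums[B hB].
have B0 : 0 <= B by have := hB 0%N; rewrite big_geq.
exists (1 + B); first by rewrite addr_ge0.
move=> p p2.
have : beta p ^+ 2 <= B.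
  apply: le_trans (hB p.+1); rewrite big_nat_recr//=.
  rewrite -[leLHS]add0r; apply: lerD.
    by apply: sumr_ge0 => q _; apply: mulr_ge0; [exact: exprn_ge0|exact: sqr_ge0].
  by rewrite ler_peMl ?sqr_ge0// exprn_ege1// ler1n.
have := sqr_ge0 (beta p - 1); rewrite sqrrB1.
by have := beta_ge0 p2; nra.
Qed.

Lemma coupling_ge0 N p : (2 <= p)%N -> 0 <= coupling beta N p.
Proof. by move=> p2; rewrite divr_ge0 ?powR_ge0// beta_ge0. Qed.

Lemma coupling_le (B : R) N p q : (0 < N)%N -> (2 <= p)%N -> (q < p)%N ->
  beta p <= B -> coupling beta N p <= B / Num.sqrt N%:R ^+ q.
Proof.
case: p => // p N0 p2 qp bB; rewrite couplingE.
have s1 : 1 <= Num.sqrt N%:R :> R by rewrite -[leLHS]sqrtr1 ler_wsqrtr// ler1n.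
have s0 : 0 < Num.sqrt N%:R :> R by rewrite (lt_le_trans _ s1).
apply: ler_pM => //; first exact: beta_ge0.
by rewrite lef_pV2 ?posrE ?exprn_gt0// ler_weXn2l.
Qed.

Lemma pow2_sqr_ge p (x : R) : x ^+ 2 <= 2 ^+ p * x ^+ 2.
Proof. by rewrite ler_peMl ?sqr_ge0// exprn_ege1// ler1n. Qed.

(** With [s = sqrt N], [N^p a_p^2 = beta_p^2 s^2] and [a_p <= B / s^3] since
    [p >= 4]; one factor [1 / s] survives. *)
Lemma level_le_third_moment (B K W : R) N p : (0 < N)%N -> (4 <= p)%N ->
  0 <= B -> beta p <= B -> 0 <= K -> W <= coupling beta N p * K ->
  N%:R ^+ p * (coupling beta N p ^+ 2 * W) <=
  2 ^+ p * beta p ^+ 2 * (B * K / Num.sqrt N%:R).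
Proof.
move=> N0 p4 B0 bB K0 hW.
have p2 : (2 <= p)%N by exact: leq_trans p4.
have s0 : 0 < Num.sqrt N%:R :> R by rewrite sqrtr_gt0 ltr0n.
rewrite mulrA coupling_sqr//; last exact: ltnW.
apply: (@le_trans _ _ (beta p ^+ 2 * (B * K / Num.sqrt N%:R))); last first.
  by rewrite ler_wpM2r ?pow2_sqr_ge// !mulr_ge0// invr_ge0 ltW.
rewrite -mulrA ler_wpM2l ?sqr_ge0//.
apply: (le_trans (ler_wpM2l (ler0n _ N) hW)).
have hc := coupling_le N0 p2 p4 bB.
rewrite mulrA (mulrAC B) ler_wpM2r//.
apply: (le_trans (ler_wpM2l (ler0n _ N) hc)).
have -> : N%:R * (B / Num.sqrt N%:R ^+ 3) = B / Num.sqrt N%:R :> R; last exact: lexx.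
rewrite -[X in X * _](@sqr_sqrtr R N%:R)//; field; exact: lt0r_neq0.
Qed.

(** With [s = sqrt N], [N^p a_p^4 = beta_p^2 (s a_p)^2] and [a_p <= B / s].  For
    [p = 2] no power of [N] is left and the decay comes from [W'] alone. *)
Lemma level_le_fourth_moment (B W W' : R) N p : (0 < N)%N -> (2 <= p)%N ->
  0 <= B -> beta p <= B -> 0 <= W -> W <= W' ->
  N%:R ^+ p * (coupling beta N p ^+ 4 * W) <=
  2 ^+ p * beta p ^+ 2 * (B ^+ 2 * W').
Proof.
move=> N0 p2 B0 bB W0 WW'.
have s0 : 0 < Num.sqrt N%:R :> R by rewrite sqrtr_gt0 ltr0n.
have -> : coupling beta N p ^+ 4 = coupling beta N p ^+ 2 * coupling beta N p ^+ 2.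
  by rewrite -exprD.
rewrite -mulrA mulrA coupling_sqr//; last exact: ltnW.
apply: (@le_trans _ _ (beta p ^+ 2 * (B ^+ 2 * W'))); last first.
  by rewrite ler_wpM2r ?pow2_sqr_ge// mulr_ge0 ?sqr_ge0// (le_trans W0).
rewrite -mulrA ler_wpM2l ?sqr_ge0// mulrA; apply: ler_pM => //.
  by rewrite mulr_ge0 ?ler0n// sqr_ge0.
have hc := coupling_le N0 p2 p2 bB.
rewrite expr1 ler_pdivlMr// in hc.
rewrite -[X in X * _](@sqr_sqrtr R N%:R)// -exprMn mulrC.
by rewrite lerXn2r ?nnegrE// mulr_ge0 ?coupling_ge0// ltW.
Qed.

End level_bounds.

(** * The law of the disorder *)

Section disorder_law.
Context (R : realType) d0 (T0 : measurableType d0) (P0 : probability T0 R).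
Variable y0 : {RV P0 >-> R}.

Lemma integrable_law_norm_pow k :
  (\int[P0]_w (`|y0 w| ^+ k)%:E < +oo)%E ->
  (distribution P0 y0).-integrable setT (EFin \o (fun x : R => `|x| ^+ k)).
Proof.
have mp : measurable_fun setT (fun x : R => `|x| ^+ k).
  by apply: measurable_funX; exact: normr_measurable.
move=> fin; apply/(integrable_distribution y0 mp); apply/integrableP; split.
  by apply/measurable_EFinP; exact: measurableT_comp.
by under eq_integral do rewrite /= ger0_norm ?exprn_ge0//.
Qed.

Lemma law_moment k :
  (distribution P0 y0).-integrable setT (EFin \o (fun x : R => x ^+ k)) ->
  ('E_P0[fun w => (y0 w ^+ k)%R] = (\int[distribution P0 y0]_x (x ^+ k))%:E)%E.
Proof.
move=> ik; rewrite unlock -(@integral_distribution_EFin _ _ _ _ _ _ y0 (fun x => x ^+ k))//.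
by rewrite fineK// integrable_fin_num.
Qed.

Hypothesis y0_mean : ('E_P0[y0] = 0)%E.
Hypothesis y0_var : ('V_P0[y0] = 1)%E.

Lemma law_second_moment : (\int[P0]_w (`|y0 w| ^+ 2)%:E = 1)%E.
Proof.
rewrite -y0_var /variance covariance.unlock y0_mean expectation.unlock.
apply: eq_integral => w _; rewrite real_normK ?num_real//.
by rewrite -[RHS]/(((y0 w - 0) * (y0 w - 0))%:E) subr0 expr2.
Qed.

Lemma law_integrable_sqr :
  (distribution P0 y0).-integrable setT (EFin \o (fun x : R => `|x| ^+ 2)).
Proof. by apply: integrable_law_norm_pow; rewrite law_second_moment ltry. Qed.

Lemma law_mean : \int[distribution P0 y0]_x (x ^+ 1) = 0.
Proof.
have := law_moment (integrable_pow (isT : 1 <= 2)%N law_integrable_sqr).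
by rewrite (_ : (fun w => y0 w ^+ 1) = y0)// y0_mean => -[<-].
Qed.

Lemma law_variance : \int[distribution P0 y0]_x (x ^+ 2) = 1.
Proof.
have := law_moment (integrable_pow (leqnn 2) law_integrable_sqr).
suff -> : ('E_P0[fun w => (y0 w ^+ 2)%R] = 1)%E by case.
rewrite unlock -law_second_moment; apply: eq_integral => w _.
by rewrite real_normK ?num_real.
Qed.

End disorder_law.

Theorem theorem5 (R : realType) (beta : nat -> R) (h : R)
  (beta_ge0 : forall p : nat, (2 <= p)%N -> 0 <= beta p)
  (beta_sum : (\sum_(2 <= p <oo) (2 ^+ p * beta p ^+ 2)%:E < +oo)%E)
  (d0 : measure_display) (T0 : measurableType d0) (P0 : probability T0 R)
  (y0 : {RV P0 >-> R})
  (y0_mean : ('E_P0[y0] = 0)%E) (y0_var : ('V_P0[y0] = 1)%E)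
  (d : nat -> measure_display) (T : forall N : nat, measurableType (d N))
  (P : forall N : nat, probability (T N) R)
  (y : forall N : nat, disorder_index N -> {RV (P N) >-> R})
  (y_iid : forall N : nat,
    iid_on (@model_index N) (y N) (distribution P0 y0))
  (d' : nat -> measure_display) (T' : forall N : nat, measurableType (d' N))
  (P' : forall N : nat, probability (T' N) R)
  (g : forall N : nat, disorder_index N -> {RV (P' N) >-> R})
  (g_iid : forall N : nat,
    iid_on (@model_index N) (g N) (normal_prob (0 : R) 1))
  (y_cond :
    [/\ beta 2%N = 0, beta 3%N = 0 &
        ('E_P0[fun w => (`|y0 w| ^+ 3)%R] < +oo)%E]
    \/
    (forall k : nat, (1 <= k <= 4)%N ->
      ('E_P0[fun w => (y0 w ^+ k)%R] =
       \int[normal_prob (0 : R) 1]_x (x ^+ k)%:E)%E)) :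
  ultrametricity beta h g -> ultrametricity beta h y.
Proof.
have [B B0 betaB] := beta_bounded beta_ge0 beta_sum.
set mu := distribution P0 y0 in y_iid.
pose nu := std_normal R.
have nu_pow k : (k <= 4)%N -> nu.-integrable setT (EFin \o (fun x : R => x ^+ k)).
  by move=> k4; exact: (integrable_pow k4 (integrable_pow4_std_normal R)).
have nu_norm k : (k <= 4)%N -> nu.-integrable setT (EFin \o (fun x : R => `|x| ^+ k)).
  move=> k4; under eq_fun do rewrite -normrX.
  exact: integrable_norm (nu_pow k k4).
have g_iid' N : iid_on (@model_index N) (g N) nu by exact: g_iid.
have mom0 : \int[mu]_x (x ^+ 0) = \int[nu]_x (x ^+ 0).
  under eq_Rintegral do rewrite expr0; under [RHS]eq_Rintegral do rewrite expr0.
  by rewrite (Rintegral_cst_probability mu 1) (Rintegral_cst_probability nu 1).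
have mu1 : \int[mu]_x (x ^+ 1) = 0 by exact: (law_mean y0_mean y0_var).
have mu2 : \int[mu]_x (x ^+ 2) = 1 by exact: (law_variance y0_mean y0_var).
have nu1 := std_normal_mean R; have nu2 := std_normal_variance R.
case: y_cond => [[beta2 beta3 y3]|ymom].
(* two matching moments; the remainder is controlled by the third one *)
- have imu2 := law_integrable_sqr y0_mean y0_var.
  have imu3 : mu.-integrable setT (EFin \o (fun x : R => `|x| ^+ 3)).
    by apply: integrable_law_norm_pow; move: y3; rewrite unlock.
  pose K := \int[mu]_x (`|x| ^+ 3) + \int[nu]_x (`|x| ^+ 3).
  have K0 : 0 <= K by rewrite addr_ge0//; apply: Rintegral_ge0 => x _; exact: exprn_ge0.
  apply: (@ultrametricity_transfer _ beta h beta_ge0 beta_sum _ _ _ y _ _ _ g mu nu 2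
    (fun N => B * K / Num.sqrt N%:R)) => //.
  + exact: nu_norm.
  + by case=> [|[|[|]]]//= _; rewrite ?mu1 ?mu2 ?nu1 ?nu2.
  + by move=> N; rewrite !mulr_ge0// invr_ge0 sqrtr_ge0.
  + rewrite -[X in _ --> X](mulr0 (B * K)); apply: cvgM; first exact: cvg_cst.
    exact: cvg_inv_sqrt_nat.
  + move=> N p N0 p2; case: (leqP 4 p) => p4.
      apply: (level_le_third_moment beta_ge0) => //; first exact: betaB.
      rewrite /K mulrDr lerD//; apply: capped_moment_le; rewrite ?coupling_ge0//; exact: nu_norm.
    have bp0 : beta p = 0 by case: p p2 p4 => [|[|[|[|]]]].
    by rewrite /coupling bp0 mul0r expr0n !(mul0r, mulr0).
(* four matching moments; the remainder is the capped fourth moment *)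
- have y4 : (\int[P0]_w (`|y0 w| ^+ 4)%:E < +oo)%E.
    have := ymom 4%N isT; rewrite unlock => E4.
    under eq_integral do rewrite -normrX ger0_norm ?exprn_even_ge0//.
    rewrite E4; apply: le_lt_trans (integral_pow4_normal_lty R).
    rewrite le_eqVlt; apply/orP; left; apply/eqP; apply: eq_integral => x _.
    by rewrite -normrX ger0_norm// exprn_even_ge0.
  have imu4 : mu.-integrable setT (EFin \o (fun x : R => `|x| ^+ 4)).
    exact: integrable_law_norm_pow.
  pose b N := B / Num.sqrt N%:R.
  have b0 N : 0 <= b N by rewrite mulr_ge0// invr_ge0 sqrtr_ge0.
  have bcvg : b N @[N --> \oo] --> (0 : R).
    rewrite -[X in _ --> X](mulr0 B); apply: cvgM; first exact: cvg_cst.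
    exact: cvg_inv_sqrt_nat.
  apply: (@ultrametricity_transfer _ beta h beta_ge0 beta_sum _ _ _ y _ _ _ g mu nu 4
    (fun N => B ^+ 2 * (capped_moment 4 mu (b N) + capped_moment 4 nu (b N)))) => //.
  + exact: nu_norm.
  + move=> [|k] k4 //.
    have ik := integrable_pow k4 imu4.
    apply: EFin_inj; rewrite -law_moment// ymom// -integral_std_normal; last exact: nu_pow.
    by rewrite fineK// integrable_fin_num//; exact: nu_pow.
  + by move=> N; rewrite mulr_ge0 ?sqr_ge0// addr_ge0// capped_moment_ge0.
  + rewrite -[X in _ --> X](mulr0 (B ^+ 2)); apply: cvgM; first exact: cvg_cst.
    rewrite -[X in _ --> X](addr0 0); apply: cvgD; apply: capped_moment_cvg0 => //.
    exact: nu_norm.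
  + move=> N p N0 p2.
    have c0 := coupling_ge0 beta_ge0 N p2.
    have cb : coupling beta N p <= b N.
      by have := coupling_le beta_ge0 N0 p2 p2 (betaB p p2); rewrite expr1.
    apply: (level_le_fourth_moment beta_ge0) => //; first exact: betaB.
      by rewrite addr_ge0// capped_moment_ge0.
    by rewrite lerD// le_capped_moment//; exact: nu_norm.
Qed.
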